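(* Let $t\ge 2$, $q\ge 0$ and $s_1,\dots,s_t\ge 3$ be integers, and let $G=K_1\vee (C_{s_1}\cup C_{s_2}\cup\cdots\cup C_{s_t}\cup qK_2)$. If $G$ has at least $52$ vertices, then $G$ is determined by its signless Laplacian spectrum: every simple graph whose signless Laplacian spectrum equals that of $G$ is isomorphic to $G$.
   Context: All graphs are finite, simple and undirected unless stated otherwise. $K_n$, $C_n$ denote the complete graph and the cycle on $n$ vertices; $G\cup H$ is the disjoint union; $qG$ is the disjoint union of $q$ copies of $G$ ($0K_2$ is the empty graph); $G\vee H$ is the join, obtained from $G\cup H$ by adding all edges between $V(G)$ and $V(H)$. The signless Laplacian of $G$ is $Q(G)=A(G)+D(G)$, where $A(G)$ is the adjacency matrix and $D(G)$ the diagonal matrix of vertex degrees; its eigenvalues (with multiplicities) form the signless Laplacian spectrum ($Q$-spectrum). *)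

(* Defs.v *)
From HB Require Import structures.
From mathcomp Require Import all_boot all_order all_algebra all_field.
Set Implicit Arguments. Unset Strict Implicit. Unset Printing Implicit Defensive.
Import Order.TTheory GRing.Theory Num.Theory.
Local Open Scope ring_scope.

Definition simple_graph (V : finType) (e : rel V) : Prop :=
  symmetric e /\ irreflexive e.

Definition degree (V : finType) (e : rel V) (x : V) : nat := #|[pred y | e x y]|.

(* Signless Laplacian Q = A + D, indexed by 'I_#|V| via the enumeration of V,
   with entries in algC (algebraically closed, so all eigenvalues exist). *)
Definition signless_laplacian (V : finType) (e : rel V) : 'M[algC]_#|V| :=
  \matrix_(i, j) ((e (enum_val i) (enum_val j))%:R
                  + (i == j)%:R * (degree e (enum_val i))%:R).

Definition Q_eig_mult (V : finType) (e : rel V) (x : algC) : nat :=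
  mup x (char_poly (signless_laplacian e)).

Definition Q_cospectral (V W : finType) (e : rel V) (f : rel W) : Prop :=
  forall x : algC, Q_eig_mult e x = Q_eig_mult f x.

Definition graph_iso (V W : finType) (e : rel V) (f : rel W) : Prop :=
  exists g : V -> W, bijective g /\ forall x y, e x y = f (g x) (g y).

(* The graph K_1 \/ (C_{s_1} u ... u C_{s_t} u q K_2).
   Vertices: None = the K_1 vertex; Some (inl (existT i a)) = vertex a of the
   cycle C_{s_i} (a : 'I_(s i)); Some (inr (k, b)) = endpoint b of the k-th K_2. *)
Definition wheel_vert (t : nat) (s : 'I_t -> nat) (q : nat) : finType :=
  option ({i : 'I_t & 'I_(s i)} + ('I_q * bool)).

Definition cyc_adj (t : nat) (s : 'I_t -> nat) (u v : {i : 'I_t & 'I_(s i)}) : bool :=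
  (tag u == tag v) &&
  (((tagged u).+1 %% s (tag u) == tagged v)%N || ((tagged v).+1 %% s (tag u) == tagged u)%N).

Definition wheel_adj (t : nat) (s : 'I_t -> nat) (q : nat) : rel (wheel_vert s q) :=
  fun x y =>
    match x, y with
    | None, None => false
    | None, Some _ => true
    | Some _, None => true
    | Some (inl u), Some (inl v) => cyc_adj u v
    | Some (inr (k, b)), Some (inr (k', b')) => (k == k') && (b != b')
    | _, _ => false
    end.

Arguments wheel_vert {t} s q.
Arguments wheel_adj {t} s q x y.

(* Main.v *)
From HB Require Import structures.
Require Import Defs.
From mathcomp Require Import all_boot all_order all_algebra all_field.
From mathcomp Require Import fingroup perm.
From mathcomp Require Import ring zify.
From Stdlib Require Import FunctionalExtensionality.
Set Implicit Arguments. Unset Strict Implicit. Unset Printing Implicit Defensive.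
Import Order.TTheory GRing.Theory Num.Theory.
Local Open Scope ring_scope.

(** Write an eigenvalue as [1 + y] with [y = 2 + w + w^-1].  On
    [K_1 \/ (cycles u paths)] the eigenvectors that vanish at the hub and on the
    paths are combinations of [w^a] and [w^-a] on the cycles whose length [s]
    satisfies [w^s = 1]; they contribute an even number to the multiplicity.
    For the given graph this shows that all eigenvalues are at least 1, that at
    most one exceeds 5, and that those strictly between 1 and 2 have even
    multiplicity.

    Let [f] be cospectral to it.  The smallest eigenvalue forces minimum degree
    2, and the bound on the second largest one forces all degrees but one to be
    at most 4; the sums of the degrees and of their squares then force a vertex
    adjacent to all others, the other degrees being 2 or 3.  So [f] is a join of [K_1] with
    cycles and paths, and the trace gives the number [q] of paths.

    If some path is not a [K_2], take the smallest nonzero eigenvalue [y1 < 1]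
    carried by the paths (or [y1 = 0] for a path of odd order).  Its eigenvector
    has nonzero sum, so coupling to the hub pushes an eigenvalue strictly below
    [1 + y1], with an eigenvector not vanishing at the hub; this makes a
    multiplicity odd, or an eigenvalue smaller than 1.  Hence all paths are
    [K_2], and the multiplicities at primitive [m]-th roots of unity [w] count
    the cycles of length divisible by [m], which determines the lengths. *)

(** * Spectral theorem *)

Notation fvec V := {ffun V -> algC^o}.

(** The operator of [signless_laplacian] on functions of vertices, free of the enumeration of [V];
    the field [eb_mult] below ties it back to the matrix. *)
Definition Qop (V : finType) (e : rel V) (u : fvec V) : fvec V :=
  [ffun v => \sum_(w | e v w) (u v + u w)].

Definition ip (V : finType) (u v : fvec V) : algC := \sum_x u x * (v x)^*.

(** Eigenvectors are indexed by [V] itself, as there are [#|V|] of them, so a multiplicity is the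
    cardinal of a fibre of [lam]. *)
Record eigenbasis (V : finType) (e : rel V) (lam : V -> algC)
    (phi : V -> fvec V) : Prop := Eigenbasis {
  eb_eig : forall i, Qop e (phi i) = lam i *: phi i;
  eb_real : forall i, lam i \is Num.real;
  eb_ortho : forall i j, ip (phi i) (phi j) = (i == j)%:R;
  eb_exp : forall u, u = \sum_i ip u (phi i) *: phi i;
  eb_mult : forall x, Q_eig_mult e x = #|[pred i | lam i == x]| }.

Section QopBasics.
Variables (V : finType) (e : rel V).

Lemma Qop_linear : linear (Qop e).
Proof.
move=> a u v; apply/ffunP => x; rewrite !ffunE scaler_sumr -big_split /=.
by apply: eq_bigr => w _; rewrite !ffunE scalerDr addrACA.
Qed.
HB.instance Definition _ :=
  GRing.isLinear.Build algC (fvec V) (fvec V) _ (Qop e) Qop_linear.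

Lemma QopE (u : fvec V) v :
  Qop e u v = (degree e v)%:R * u v + \sum_(w | e v w) u w.
Proof.
by rewrite ffunE big_split /= sumr_const mulr_natl; congr (_ *+ _ + _).
Qed.

Lemma ipDl (u v w : fvec V) : ip (u + v) w = ip u w + ip v w.
Proof.
by rewrite /ip -big_split /=; apply: eq_bigr => x _; rewrite !ffunE mulrDl.
Qed.
Lemma ipZl a (u w : fvec V) : ip (a *: u) w = a * ip u w.
Proof.
by rewrite /ip mulr_sumr; apply: eq_bigr => x _; rewrite !ffunE mulrA.
Qed.
Lemma ipC (u v : fvec V) : ip v u = (ip u v)^*.
Proof.
by rewrite /ip rmorph_sum; apply: eq_bigr => x _; rewrite rmorphM /= conjCK mulrC.
Qed.
Lemma ipDr (u v w : fvec V) : ip w (u + v) = ip w u + ip w v.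
Proof. by rewrite ipC ipDl rmorphD /= -!ipC. Qed.
Lemma ipZr a (u w : fvec V) : ip w (a *: u) = a^* * ip w u.
Proof. by rewrite ipC ipZl rmorphM /= -ipC. Qed.
Lemma ipNl (u w : fvec V) : ip (- u) w = - ip u w.
Proof. by rewrite -scaleN1r ipZl mulN1r. Qed.
Lemma ipNr (u w : fvec V) : ip w (- u) = - ip w u.
Proof. by rewrite ipC ipNl rmorphN /= -ipC. Qed.
Lemma ip_suml (I : finType) (F : I -> fvec V) w :
  ip (\sum_i F i) w = \sum_i ip (F i) w.
Proof.
elim/big_ind2: _ => [|? ? ? ? <- <-|//]; last by rewrite ipDl.
by rewrite /ip big1 // => x _; rewrite ffunE mul0r.
Qed.

Lemma ip_Qop_sym : symmetric e -> forall u v : fvec V,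
  ip (Qop e u) v = ip u (Qop e v).
Proof.
move=> esym u v; rewrite /ip.
under eq_bigr => x _ do rewrite QopE mulrDl mulr_suml.
under [RHS]eq_bigr => x _ do rewrite QopE rmorphD mulrDr rmorph_sum mulr_sumr.
rewrite !big_split /=; congr (_ + _).
  by apply: eq_bigr => x _; rewrite rmorphM /= rmorph_nat mulrCA mulrA.
rewrite (exchange_big_dep predT) //=; apply: eq_bigr => x _.
by apply: eq_bigl => y; rewrite esym.
Qed.

End QopBasics.

Lemma sum_enum_val (V : finType) (R : nmodType) (F : V -> R) :
  \sum_v F v = \sum_(k < #|V|) F (enum_val k).
Proof. by rewrite (reindex (@enum_val V predT)) //; apply/onW_bij/enum_val_bij. Qed.

Local Open Scope sesquilinear_scope.

(** The matrix is Hermitian, hence unitarily diagonalizable; the conjugated rows of the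
    diagonalizing matrix [P] are the eigenvectors. *)
Lemma eigenbasis_exists (V : finType) (e : rel V) :
  symmetric e -> exists lam phi, @eigenbasis V e lam phi.
Proof.
move=> esym; set M := signless_laplacian e.
have Mherm : M \is hermsymmx.
  apply/is_hermitianmxP; rewrite expr0 scale1r; apply/matrixP => i j.
  rewrite !mxE rmorphD rmorphM !rmorph_nat /= esym (eq_sym j).
  by case: eqP => [->//|_]; rewrite !mul0r.
have Mnorm := hermitian_normalmx Mherm.
have /orthomx_spectralP MD := Mnorm.
have Dreal := hermitian_spectral_diag_real Mherm.
set P := spectralmx M in MD *; set D := spectral_diag M in MD Dreal *.
have PU : P \is unitarymx by apply: spectral_unitarymx.
have PV : invmx P = P^t* by apply: invmx_unitary.
have PPt : P *m P^t* = 1%:M by apply/unitarymxP.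
have PtP : P^t* *m P = 1%:M by rewrite -PV mulVmx // unitarymx_unit.
pose lam (i : V) := D 0 (enum_rank i).
pose phi (i : V) : fvec V := [ffun v => (P (enum_rank i) (enum_rank v))^*].
exists lam, phi; split.
- move=> i; apply/ffunP => v; rewrite QopE.
  have : (M *m P^t*) (enum_rank v) (enum_rank i) =
         (P^t* *m diag_mx D) (enum_rank v) (enum_rank i).
    by rewrite MD PV -!mulmxA PPt mulmx1.
  rewrite mul_mx_diag !mxE => eqM.
  transitivity ((P (enum_rank i) (enum_rank v))^* * D 0 (enum_rank i)); last first.
    by rewrite !ffunE mulrC.
  rewrite -eqM [phi i v]ffunE.
  have -> : \sum_(w | e v w) phi i w =
      \sum_w (e v w)%:R * phi i w.
    by rewrite big_mkcond /=; apply: eq_bigr => w _; case: (e v w); rewrite ?mul1r ?mul0r.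
  rewrite (sum_enum_val (fun w => (e v w)%:R * phi i w)).
  under [RHS]eq_bigr => k _ do rewrite !mxE enum_rankK mulrDl.
  rewrite big_split /= [RHS]addrC; congr (_ + _); last first.
    by apply: eq_bigr => k _; rewrite ffunE enum_valK.
  rewrite (bigD1 (enum_rank v)) //= eqxx mul1r big1 ?addr0 // => k.
  by rewrite eq_sym => /negbTE->; rewrite !mul0r.
- by move=> i; have /mxOverP := Dreal; apply.
- move=> i j; have /matrixP/(_ (enum_rank j) (enum_rank i)) := PPt.
  rewrite !mxE (inj_eq enum_rank_inj) eq_sym => <-.
  rewrite /ip (sum_enum_val (fun x => phi i x * (phi j x)^*)).
  by apply: eq_bigr => k _; rewrite !ffunE enum_valK !mxE conjCK mulrC.
- move=> u; apply/ffunP => v; rewrite sum_ffunE.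
  under eq_bigr => i _ do rewrite !ffunE /ip [_ *: _]mulr_suml.
  rewrite exchange_big /= (bigD1 v) //=.
  have key x : \sum_i u x * (phi i x)^* * (P (enum_rank i) (enum_rank v))^*
      = u x * (x == v)%:R.
    have /matrixP/(_ (enum_rank v) (enum_rank x)) := PtP.
    rewrite !mxE (inj_eq enum_rank_inj) eq_sym => <-.
    rewrite mulr_sumr sum_enum_val; apply: eq_bigr => k _.
    by rewrite !mxE ffunE enum_valK conjCK -mulrA; congr (_ * _); rewrite mulrC.
  rewrite key eqxx mulr1 big1 ?addr0 // => x /negbTE xv.
  by rewrite key xv mulr0.
- move=> x; rewrite /Q_eig_mult -/M.
  (* Conjugation by [P] does not change the characteristic polynomial, so it splits over the
     diagonal entries of [D]. *)
  have -> : char_poly M = \prod_(y <- [seq D 0 i | i <- enum 'I_#|V|]) ('X - y%:P).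
    rewrite /char_poly.
    have -> : char_poly_mx M = map_mx polyC (invmx P) *m char_poly_mx (diag_mx D) *m map_mx polyC P.
      rewrite /char_poly_mx mulmxBr mulmxBl [in LHS]MD !map_mxM; congr (_ - _).
      rewrite scalar_mxC -mulmxA -map_mxM mulVmx ?unitarymx_unit //.
      by rewrite map_mx1 mulmx1.
    rewrite !det_mulmx mulrC mulrA -det_mulmx -map_mxM mulmxV ?unitarymx_unit //.
    rewrite map_mx1 det1 mul1r -/(char_poly _) char_poly_trig ?diag_mx_is_trig //.
    rewrite big_map enumT; apply: eq_bigr => i _; by rewrite mxE eqxx.
  rewrite mu_prod_XsubC count_map -sum1_count big_enum_cond /=.
  rewrite -[RHS]sum1_card (reindex (@enum_rank V)) //.
  by apply: onW_bij; exists enum_val; [exact: enum_rankK|exact: enum_valK].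
Qed.

Local Close Scope sesquilinear_scope.

Lemma dim_fvec (I : finType) : \dim {: fvec I} = #|I|.
Proof. by rewrite dimvf [LHS]muln1. Qed.

Section DimLemmas.
Variables (K : fieldType) (aT rT : vectType K) (f : aT -> rT).
Hypothesis f_lin : linear f.

Lemma dim_ker_img (U U1 : {vspace aT}) (U2 : {vspace rT}) :
  (forall u, (u \in U1) = (u \in U) && (f u == 0)) ->
  (forall u, u \in U -> f u \in U2) ->
  (forall v, v \in U2 -> exists2 u, u \in U & f u = v) ->
  \dim U = (\dim U1 + \dim U2)%N.
Proof.
pose F : {linear aT -> rT} := HB.pack f (GRing.isLinear.Build _ _ _ _ f f_lin).
move=> U1P fU fS; rewrite -(limg_ker_dim (linfun F) U); congr (_ + _)%N; congr (\dim _).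
  by apply/vspaceP => u; rewrite U1P memv_cap memv_ker lfunE.
apply/vspaceP => v; apply/memv_imgP/idP => [[u uU ->]|/fS[u uU <-]].
  by rewrite lfunE; apply: fU.
by exists u; rewrite ?lfunE.
Qed.

Lemma dim_bij (U : {vspace aT}) (U2 : {vspace rT}) :
  (forall u, u \in U -> f u = 0 -> u = 0) ->
  (forall u, u \in U -> f u \in U2) ->
  (forall v, v \in U2 -> exists2 u, u \in U & f u = v) ->
  \dim U = \dim U2.
Proof.
move=> f0 fU fS; rewrite (@dim_ker_img U 0%VS U2) ?dimv0 // => u.
rewrite memv0; apply/eqP/andP => [->|[uU /eqP]]; last exact: f0.
have := f_lin (-1) 0 0; rewrite addr0 scaler0 scaleN1r addrC subrr => ->.
by rewrite mem0v.
Qed.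

End DimLemmas.

Definition Espace (V : finType) (e : rel V) (x : algC) : {vspace fvec V} :=
  lker (linfun (Qop e) - x *: \1%VF).

Lemma EspaceP (V : finType) (e : rel V) x (u : fvec V) :
  reflect (Qop e u = x *: u) (u \in Espace e x).
Proof.
rewrite memv_ker add_lfunE opp_lfunE scale_lfunE id_lfunE lfunE subr_eq0; exact: eqP.
Qed.

Section EigenbasisTheory.
Variables (V : finType) (e : rel V) (lam : V -> algC) (phi : V -> fvec V).
Hypothesis eb : eigenbasis e lam phi.

Lemma eigenbasis_coef (c : V -> algC) i : ip (\sum_j c j *: phi j) (phi i) = c i.
Proof.
rewrite ip_suml (bigD1 i) //= ipZl (eb_ortho eb) eqxx mulr1 big1 ?addr0 //.
by move=> j /negbTE ji; rewrite ipZl (eb_ortho eb) ji mulr0.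
Qed.

Lemma Qop_exp (u : fvec V) : Qop e u = \sum_i (lam i * ip u (phi i)) *: phi i.
Proof.
rewrite {1}(eb_exp eb u) linear_sum; apply: eq_bigr => i _.
by rewrite linearZ /= (eb_eig eb) scalerA mulrC.
Qed.

Lemma eigenvalue_coef (u : fvec V) x : Qop e u = x *: u ->
  forall i, lam i != x -> ip u (phi i) = 0.
Proof.
move=> Qu i lix; have := congr1 (fun z => ip z (phi i)) Qu.
rewrite Qop_exp (eigenbasis_coef (fun i => lam i * ip u (phi i))) ipZl.
move/eqP; rewrite -subr_eq0 -mulrBl mulf_eq0 subr_eq0 (negbTE lix) /=.
by move/eqP.
Qed.

(** Algebraic and geometric multiplicities agree: the coordinates along the [phi i] with [lam i = x]
    parametrize the eigenspace. Multiplicities can thus be found by solving linear equations. *)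
Lemma dim_Espace x : \dim (Espace e x) = Q_eig_mult e x.
Proof.
rewrite (eb_mult eb); pose I : finType := {i | lam i == x}.
have -> : #|[pred i | lam i == x]| = #|I| by rewrite card_sig.
pose f (u : fvec V) : fvec I := [ffun i : I => ip u (phi (val i))].
have lf : linear f.
  by move=> a u v; apply/ffunP => i; rewrite !ffunE ipDl ipZl.
rewrite -dim_fvec; apply: (dim_bij lf) => [u /EspaceP Qu fu0||v _].
- rewrite (eb_exp eb u) big1 // => i _.
  have [lix|/(eigenvalue_coef Qu)->] := eqVneq (lam i) x; last by rewrite scale0r.
  have lix' : lam i == x by apply/eqP.
  have := congr1 (fun g : fvec I => g (exist _ i lix')) fu0.
  by rewrite !ffunE /= => ->; rewrite scale0r.
- by move=> u _; rewrite memvf.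
pose c i : algC := if insub i is Some j then v (j : I) else 0.
exists (\sum_i c i *: phi i).
  apply/EspaceP; rewrite linear_sum scaler_sumr; apply: eq_bigr => i _.
  rewrite linearZ /= (eb_eig eb) !scalerA /c.
  by case: insubP => [j /eqP lix _|_]; rewrite ?mul0r ?mulr0 // lix mulrC.
apply/ffunP => i; rewrite ffunE eigenbasis_coef /c insubT //=.
  exact: (valP i).
by move=> li; congr (v _); apply: val_inj.
Qed.

Lemma ip_exp (u v : fvec V) : ip u v = \sum_i ip u (phi i) * (ip v (phi i))^*.
Proof.
rewrite {1}(eb_exp eb u) ip_suml; apply: eq_bigr => i _.
by rewrite ipZl -(ipC v).
Qed.

Lemma form_exp (u : fvec V) : ip (Qop e u) u = \sum_i lam i * `|ip u (phi i)| ^+ 2.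
Proof.
rewrite Qop_exp ip_suml; apply: eq_bigr => i _.
by rewrite ipZl -mulrA (ipC u) normCK.
Qed.

Lemma norm_exp (u : fvec V) : ip u u = \sum_i `|ip u (phi i)| ^+ 2.
Proof. by rewrite ip_exp; apply: eq_bigr => i _; rewrite normCK. Qed.

Lemma form_lower x (u : fvec V) :
  (forall i, ip u (phi i) != 0 -> x <= lam i) -> x * ip u u <= ip (Qop e u) u.
Proof.
move=> H; rewrite form_exp norm_exp mulr_sumr; apply: ler_sum => i _.
have [->|/H] := eqVneq (ip u (phi i)) 0; first by rewrite normr0 expr0n !mulr0.
by move=> xl; rewrite ler_wpM2r // exprn_ge0.
Qed.

Lemma form_upper x (u : fvec V) :
  (forall i, ip u (phi i) != 0 -> lam i <= x) -> ip (Qop e u) u <= x * ip u u.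
Proof.
move=> H; rewrite form_exp norm_exp mulr_sumr; apply: ler_sum => i _.
have [->|/H] := eqVneq (ip u (phi i)) 0; first by rewrite normr0 expr0n !mulr0.
by move=> xl; rewrite ler_wpM2r // exprn_ge0.
Qed.

Lemma eigenbasis_neq0 i : phi i != 0.
Proof.
apply/eqP => p0; have := eb_ortho eb i i; rewrite eqxx p0 /ip big1.
  by move/esym/eqP; rewrite oner_eq0.
by move=> x _; rewrite ffunE mul0r.
Qed.

Lemma eigenbasis_mem i : phi i \in Espace e (lam i).
Proof. by apply/EspaceP/(eb_eig eb). Qed.

Definition delta_vec (v : V) : fvec V := [ffun x => (x == v)%:R].

Lemma ip_delta (u : fvec V) v : ip u (delta_vec v) = u v.
Proof.
rewrite /ip (bigD1 v) //= ffunE eqxx rmorph1 mulr1 big1 ?addr0 //.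
by move=> x /negbTE xv; rewrite ffunE xv rmorph0 mulr0.
Qed.

Lemma Qop_delta : symmetric e -> forall v w,
  Qop e (delta_vec v) w = (w == v)%:R * (degree e v)%:R + (e v w)%:R.
Proof.
move=> esym v w; rewrite QopE ffunE; congr (_ + _).
  by case: (eqVneq w v) => [->|_]; rewrite ?mulr1 ?mul1r ?mul0r ?mulr0.
rewrite esym; case ewv: (e w v).
  rewrite (bigD1 v) //= ffunE eqxx big1 ?addr0 // => x /andP[_ /negbTE xv].
  by rewrite ffunE xv.
by rewrite big1 // => x ewx; rewrite ffunE; case: eqP ewx => // ->; rewrite ewv.
Qed.

(** The trace of [g(Q)] computed in the standard basis; it reduces to each [phi i] having norm 1. *)
Lemma sum_form_delta (g : V -> algC) :
  \sum_v \sum_i g i * `|ip (delta_vec v) (phi i)| ^+ 2 = \sum_i g i.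
Proof.
rewrite exchange_big; apply: eq_bigr => i _ /=; rewrite -mulr_sumr.
rewrite -[RHS]mulr1; congr (_ * _).
have <- : ip (phi i) (phi i) = 1 by rewrite (eb_ortho eb) eqxx.
rewrite [RHS]/ip; apply: eq_bigr => v _.
by rewrite ipC ip_delta norm_conjC normCK.
Qed.

Lemma sum_eigenvalues : irreflexive e -> \sum_i lam i = (\sum_v degree e v)%:R.
Proof.
move=> eirr; rewrite -sum_form_delta natr_sum; apply: eq_bigr => v _.
rewrite -form_exp ip_delta QopE ffunE eqxx mulr1 big1 ?addr0 // => w evw.
by rewrite ffunE; case: eqP evw => // ->; rewrite eirr.
Qed.

(** The trace of the square of Q is the sum of the squared norms of its columns; the column of [v]
    has entry [degree e v] at [v] and as many entries 1. *)
Lemma sum_sqr_eigenvalues : symmetric e -> irreflexive e ->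
  \sum_i lam i ^+ 2 = (\sum_v (degree e v ^ 2 + degree e v))%:R.
Proof.
move=> esym eirr; rewrite -sum_form_delta natr_sum; apply: eq_bigr => v _.
transitivity (ip (Qop e (delta_vec v)) (Qop e (delta_vec v))).
  rewrite Qop_exp ip_exp; apply: eq_bigr => i _.
  rewrite (eigenbasis_coef (fun i => lam i * ip (delta_vec v) (phi i))).
  rewrite rmorphM /= normCK (CrealP (eb_real eb i)); ring.
have Qd := Qop_delta esym v.
rewrite /ip (bigD1 v) //= Qd eqxx eirr addr0 mul1r rmorph_nat.
rewrite natrD natrX; congr (_ + _).
rewrite /degree -sum1_card natr_sum [RHS]big_mkcond /= [RHS](bigD1 v) //=.
rewrite inE eirr add0r; apply: eq_bigr => w /negbTE wv.
by rewrite Qd wv mul0r add0r inE; case: (e v w); rewrite ?rmorph0 ?rmorph1 ?mulr0 ?mulr1.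
Qed.

End EigenbasisTheory.

Lemma cospectral_sum (V W : finType) (lam : V -> algC) (mu : W -> algC)
    (R : nmodType) (g : algC -> R) :
  (forall x, #|[pred i | lam i == x]| = #|[pred j | mu j == x]|) ->
  \sum_i g (lam i) = \sum_j g (mu j).
Proof.
move=> H; have P : perm_eq [seq lam i | i <- enum V] [seq mu j | j <- enum W].
  have cnt (U : finType) (h : U -> algC) x :
      count_mem x [seq h i | i <- enum U] = #|[pred i | h i == x]|.
    by rewrite count_map -sum1_count big_enum_cond -sum1_card.
  by apply/allP => x _ /=; rewrite !cnt (H x).
transitivity (\sum_(x <- [seq lam i | i <- enum V]) g x).
  by rewrite big_map big_enum.
by rewrite (perm_big _ P) big_map big_enum.
Qed.

Lemma graph_iso_mult (V W : finType) (e : rel V) (f : rel W) :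
  simple_graph e -> simple_graph f -> graph_iso e f ->
  forall x, Q_eig_mult e x = Q_eig_mult f x.
Proof.
move=> [es _] [fs _] [g [[h gK hK] gP]] x.
have [l1 [p1 eb1]] := eigenbasis_exists es.
have [l2 [p2 eb2]] := eigenbasis_exists fs.
rewrite -(dim_Espace eb1) -(dim_Espace eb2).
pose F (u : fvec V) : fvec W := [ffun w => u (h w)].
have lF : linear F by move=> a u v; apply/ffunP => w; rewrite !ffunE.
have QF u : Qop f (F u) = F (Qop e u).
  apply/ffunP => w; rewrite !ffunE (reindex g) /=; last by exists h => ? _.
  by apply: eq_big => [v|v _]; rewrite ?ffunE ?gK // gP hK.
apply: (dim_bij lF).
- move=> u _ Fu; apply/ffunP => v; have := congr1 (fun z : fvec W => z (g v)) Fu.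
  by rewrite !ffunE gK.
- move=> u /EspaceP Qu; apply/EspaceP; rewrite QF Qu.
  by apply/ffunP => w; rewrite !ffunE.
move=> v /EspaceP Qv; pose u : fvec V := [ffun a => v (g a)].
have Fu : F u = v by apply/ffunP => w; rewrite !ffunE hK.
exists u => //; apply/EspaceP; apply/ffunP => a.
have := congr1 (fun z : fvec W => z (g a)) Qv; rewrite -Fu QF.
by rewrite !ffunE gK.
Qed.

(** * Degrees of a cospectral mate *)

Section Degrees.
Variables (V : finType) (e : rel V) (lam : V -> algC) (phi : V -> fvec V).
Hypotheses (esym : symmetric e) (eirr : irreflexive e).
Hypothesis eb : eigenbasis e lam phi.

(** Test vectors against the bound 1: an isolated [v] gives quotient 0 on [delta_vec v]. If [v] has
    a single neighbour [w], of degree d, then d at [v] and -1 at [w] gives form [d^2 - d] against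
    squared norm [d^2 + 1]. *)
Lemma mindegree_ge2 : (forall i, 1 <= lam i) -> forall v, (2 <= degree e v)%N.
Proof.
move=> lam1 v.
have fL u : ip u u <= ip (Qop e u) u.
  by rewrite -[X in X <= _]mul1r; apply: (form_lower eb).
have dv1 : (1 <= degree e v)%N.
  have := fL (delta_vec v); rewrite !ip_delta Qop_delta // ffunE eqxx eirr addr0 mul1r.
  by rewrite ler_nat.
have [w evw] : exists w, e v w by move/card_gt0P: dv1 => [w]; exists w.
have vw : v != w by apply: contraTneq evw => ->; rewrite eirr.
rewrite ltn_neqAle dv1 andbT; apply/eqP => dv.
set d := degree e w; pose u := d%:R *: delta_vec v - delta_vec w.
have := fL u; rewrite /u linearB linearZ /= !(ipDl, ipNl, ipZl, ipDr, ipNr, ipZr).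
rewrite !ip_delta !Qop_delta // !ffunE !eqxx eirr (eirr w) (negbTE vw) eq_sym (negbTE vw).
rewrite evw esym evw -dv -/d rmorph_nat.
rewrite -subr_ge0; set z := (X in 0 <= X) => z0.
have zE : z = - (d.+1)%:R by rewrite /z -natr1 /=; ring.
by move: z0; rewrite zE oppr_ge0 lern0.
Qed.

Hypothesis one5 : forall i j, 5 < lam i -> 5 < lam j -> i = j.

(** [A], [B], [C] are the entries of the Gram matrix of Q - 5 on the span of [a] and [b]. If it were
    positive definite, the combination orthogonal to the only eigenvector above 5 would contradict
    [form_upper]. *)
Lemma no_two_dim_above5 (a b : fvec V) (A B C : algC) :
  ip (Qop e a) a - 5 * ip a a = A ->
  ip (Qop e b) b - 5 * ip b b = C ->
  ip (Qop e a) b - 5 * ip a b = B ->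
  B \is Num.real -> 0 < A -> B ^+ 2 < A * C -> False.
Proof.
move=> EA EC EB Br A0 ABC.
have up u : (forall i, 5 < lam i -> ip u (phi i) = 0) ->
    ip (Qop e u) u - 5 * ip u u <= 0.
  move=> H; rewrite subr_le0; apply: (form_upper eb) => i.
  have lr := eb_real eb i; rewrite real_leNgt ?realn //.
  by apply: contraNN => /H ->.
have notall : ~ (forall i, 5 < lam i -> ip a (phi i) = 0).
  by move/up; rewrite EA => /(lt_le_trans A0); rewrite ltxx.
have [/existsP[i0 li0]|/existsPn none] := boolP [exists i, 5 < lam i]; last first.
  by apply: notall => i li; have := none i; rewrite li.
set c1 := ip a (phi i0); set c2 := ip b (phi i0).
have EB' : ip (Qop e b) a - 5 * ip b a = B.
  by rewrite ip_Qop_sym // ipC (ipC a b) -(CrealP Br) -EB rmorphB rmorphM /= rmorph_nat.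
have F0 : c2 * c2^* * A - c2 * c1^* * B - c1 * c2^* * B + c1 * c1^* * C <= 0.
  have /up : forall i, 5 < lam i -> ip (c2 *: a - c1 *: b) (phi i) = 0.
    by move=> i li; rewrite -(one5 li0 li) ipDl ipNl !ipZl -/c1 -/c2 mulrC subrr.
  rewrite linearB !linearZ /= !(ipDl, ipNl, ipZl, ipDr, ipNr, ipZr).
  by congr (_ <= _); rewrite -EA -EC -{1}EB -EB'; ring.
have Ar : A^* = A by apply/CrealP/gtr0_real.
(* This is [A] times the previous inequality, with the square completed. It forces [c1 = 0], so [a]
   itself is orthogonal to the eigenvector above 5, against [0 < A]. *)
have key : `|A * c2 - B * c1| ^+ 2 + (A * C - B ^+ 2) * `|c1| ^+ 2 <= 0.
  rewrite !normCK rmorphB !rmorphM /= Ar (CrealP Br).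
  have -> : (A * c2 - B * c1) * (A * c2^* - B * c1^*) + (A * C - B ^+ 2) * (c1 * c1^*)
    = A * (c2 * c2^* * A - c2 * c1^* * B - c1 * c2^* * B + c1 * c1^* * C) by ring.
  by rewrite pmulr_rle0.
have n1 : 0 <= `|A * c2 - B * c1| ^+ 2 by apply: exprn_ge0.
have n2 : 0 <= `|c1| ^+ 2 by apply: exprn_ge0.
have c10 : c1 = 0.
  apply/eqP; rewrite -normr_eq0 -sqrf_eq0 eq_le n2 andbT.
  rewrite -(pmulr_rle0 _ (_ : 0 < A * C - B ^+ 2)) ?subr_gt0 //.
  by apply: le_trans key; rewrite lerDr.
by apply: notall => i li; rewrite -(one5 li0 li).
Qed.

Hypothesis mind : forall v, (2 <= degree e v)%N.

(** Two vertices of large degree would give a plane on which Q - 5 is positive definite, spanned by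
    the indicator of [v1] and a vector living on [v2] and four of its neighbours. *)
Lemma second_degree_le4 v1 v2 : v1 != v2 -> (9 <= degree e v1)%N ->
  (degree e v2 <= 4)%N.
Proof.
move=> v12 d1; rewrite leqNgt; apply/negP => d2.
pose L := [set x | e v2 x] :\ v1.
have cL : (4 <= #|L|)%N.
  have : #|[set x | e v2 x]| = degree e v2 by rewrite cardsE.
  rewrite (cardsD1 v1) -/L; lia.
have [S SL cS] : exists2 S : {set V}, S \subset L & #|S| = 4%N.
  exists [set x in take 4 (enum L)].
    by apply/subsetP => x; rewrite inE => /mem_take; rewrite mem_enum.
  have -> : [set x in take 4 (enum L)] = [set:: take 4 (enum L)] by [].
  rewrite cardsE; have /card_uniqP -> : uniq (take 4 (enum L)).
    by apply: take_uniq; rewrite enum_uniq.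
  rewrite size_take -cardE; case: ltnP => // L4; by apply/eqP; rewrite eqn_leq L4 cL.
have SP x : x \in S -> e v2 x /\ x != v1.
  by move/(subsetP SL); rewrite !inE => /andP[-> ->].
have v2S : v2 \notin S by apply/negP => /SP[]; rewrite eirr.
have v1S : v1 \notin S by apply/negP => /SP[]; rewrite eqxx.
(* The vector with 4 at [v2] and 1 on [S] has squared norm 20 and Rayleigh
   quotient at least 6, while its coupling to [v1] is at most 8. *)
pose N x : nat := ((x == v2) * 4 + (x \in S))%N.
pose b : fvec V := [ffun x => (N x)%:R].
have sumN (g : V -> nat) : (\sum_x g x * N x = 4 * g v2 + \sum_(x in S) g x)%N.
  under eq_bigr => x _ do rewrite /N mulnDr.
  rewrite big_split /=; congr (_ + _)%N.
    rewrite (bigD1 v2) //= eqxx big1 ?addn0; first by lia.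
    by move=> x /negbTE->; rewrite muln0.
  by rewrite [RHS]big_mkcond; apply: eq_bigr => x _; case: (x \in S); rewrite ?muln1 ?muln0.
have bN x : b x = (N x)%:R by rewrite ffunE.
pose G x := (degree e x * N x + \sum_(w | e x w) N w)%N.
have Qb x : Qop e b x = (G x)%:R.
  by rewrite QopE bN /G natrD natrM natr_sum; congr (_ + _); apply: eq_bigr => w _; rewrite bN.
have ipN (u : fvec V) (g : V -> nat) : (forall x, u x = (g x)%:R) ->
    ip u b = (4 * g v2 + \sum_(x in S) g x)%:R.
  move=> ug; rewrite -sumN natr_sum; apply: eq_bigr => x _.
  by rewrite ug bN rmorph_nat natrM.
have nb : ip b b = 20.
  rewrite (ipN b N) // /N eqxx (negbTE v2S) (eq_bigr (fun=> 1%N)) ?sum1_card ?cS //.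
  by move=> x xS; rewrite xS; case: eqP => // E; rewrite -E xS in v2S.
have Gv2 : (24 <= G v2)%N.
  have : (4 <= \sum_(w | e v2 w) N w)%N.
    rewrite (bigID (mem S)) /=; apply: leq_trans (leq_addr _ _).
    rewrite -cS -sum1_card [leqRHS](eq_bigl (mem S)).
      by apply: leq_sum => x xS; rewrite /N xS addn1.
    move=> x /=; have [xS|_] := boolP (x \in S); last by rewrite andbF.
    by rewrite (SP _ xS).1.
  by rewrite /G /N eqxx; lia.
have GS x : x \in S -> (6 <= G x)%N.
  move=> xS; have [e2x _] := SP _ xS.
  have : (4 <= \sum_(w | e x w) N w)%N.
    by rewrite (bigD1 v2) /= ?[e x v2]esym // {1}/N eqxx mul1n -addnA leq_addr.
  have := mind x; rewrite /G {2}/N xS; nia.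
have form_b : 120 <= ip (Qop e b) b.
  rewrite (ipN _ G) // ler_nat.
  have : (\sum_(x in S) 6 <= \sum_(x in S) G x)%N by apply: leq_sum => x /GS.
  by rewrite sum_nat_const cS; lia.
pose g1 x := ((x == v1) * degree e v1 + e v1 x)%N.
have cross : ip (Qop e (delta_vec v1)) b = (4 * g1 v2 + \sum_(x in S) g1 x)%:R.
  by apply: ipN => x; rewrite Qop_delta // natrD natrM.
have cr8 : (4 * g1 v2 + \sum_(x in S) g1 x <= 8)%N.
  have : (\sum_(x in S) g1 x <= \sum_(x in S) 1)%N.
    apply: leq_sum => x /SP[_ /negbTE xv1].
    by rewrite /g1 xv1; case: (e v1 x).
  rewrite sum_nat_const cS /g1 eq_sym (negbTE v12) mul0n; case: (e v1 v2); lia.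
have ip1b : ip (delta_vec v1) b = 0.
  rewrite ipC ip_delta bN /N (negbTE v12) (negbTE v1S) rmorph_nat //.
apply: (@no_two_dim_above5 (delta_vec v1) b _ _ _ erefl erefl erefl).
- by rewrite ip1b mulr0 subr0 cross realn.
- rewrite !ip_delta Qop_delta // ffunE eqxx eirr addr0 mul1r mulr1 subr_gt0 ltr_nat; lia.
rewrite ip1b mulr0 subr0 cross nb !ip_delta Qop_delta // ffunE eqxx eirr addr0 mul1r mulr1.
(* Here [A] is at least 9 - 5, [C] at least 120 - 5 * 20, and [B^2] at most 64, which is less than
   80. *)
apply: (@lt_le_trans _ _ (4 * 20)).
  rewrite -natrX -natrM ltr_nat; move: cr8; set z := (_ + _)%N; nia.
apply: ler_pM => //.
  by rewrite lerBrDr -natrD ler_nat; lia.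
by rewrite lerBrDr -natrM -natrD.
Qed.

End Degrees.

(** The two sums are those of the given graph, with [n3] vertices on cycles and [q] edges. With all
    degrees at most 12 the second sum would be at most 13 times the first, too small for this [n].
    So some degree is at least 13 and the others lie in 2..4; comparing the sums of D - 2 and of (D
    - 2)(D - 3) over these forces the large degree to be [n - 1]. *)
Lemma degree_count (W : finType) (D : W -> nat) n3 q :
  let n := (1 + n3 + 2 * q)%N in
  #|W| = n -> (52 <= n)%N ->
  (\sum_v D v = 3 * (n - 1) + n3)%N ->
  (\sum_v (D v ^ 2 + D v) = (n - 1) ^ 2 + (n - 1) + 12 * n3 + 12 * q)%N ->
  (forall v, 2 <= D v)%N -> (forall v, D v <= n - 1)%N ->
  (forall v1 v2, v1 != v2 -> 9 <= D v1 -> D v2 <= 4)%N ->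
  exists2 h, D h = (n - 1)%N & forall v, v != h -> (D v <= 3)%N.
Proof.
move=> n cW n52; have n1 : (n - 1 = n3 + 2 * q)%N by rewrite /n; lia.
rewrite n1; set N := (n3 + 2 * q)%N => S1 S2 D2 Dn D4.
have N51 : (51 <= N)%N by rewrite /N; move: n52; rewrite /n; lia.
have NN : (51 * N <= N * N)%N by rewrite leq_mul2r N51 orbT.
have [/existsP[h Dh]|/existsPn no] := boolP [exists v, (13 <= D v)%N]; last first.
  have : (\sum_v (D v ^ 2 + D v) <= \sum_v 13 * D v)%N.
    apply: leq_sum => v _; have := no v; rewrite -leqNgt => Dv.
    have : (D v * D v <= 12 * D v)%N by rewrite leq_mul2r Dv orbT.
    by rewrite -mulnn; lia.
  rewrite -big_distrr /= S1 S2 -mulnn; move: NN N51.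
  by move: (N * N)%N => N2; rewrite /N; lia.
have D4' v : v != h -> (D v <= 4)%N by move=> vh; apply: (D4 h); rewrite 1?eq_sym //; lia.
rewrite (bigD1 h) //= in S1; rewrite (bigD1 h) //= in S2; move: S1 S2.
set T1 := (\sum_(v | v != h) D v)%N; set T2 := (\sum_(v | v != h) (D v ^ 2 + D v))%N => S1 S2.
have c1 : (\sum_(v | v != h) 1 = N)%N.
  by rewrite sum1_card; have := cardC1 h; rewrite cW => ->; rewrite -subn1 n1.
have E1 : (T1 = 2 * N + \sum_(v | v != h) (D v - 2))%N.
  rewrite -c1 big_distrr -big_split /=; apply: eq_bigr => v _; have := D2 v; lia.
have E2 : (T2 + 6 * N = 6 * T1 + \sum_(v | v != h) (D v - 2) * (D v - 3))%N.
  rewrite -c1 !big_distrr -!big_split /=; apply: eq_bigr => v /D4'; have := D2 v.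
  by case: (D v) => [|[|[|[|[|]]]]].
have E3 : (\sum_(v | v != h) (D v - 2) * (D v - 3) <= \sum_(v | v != h) (D v - 2))%N.
  by apply: leq_sum => v /D4'; case: (D v) => [|[|[|[|[|]]]]].
move: E1 E2 E3; set X := (\sum_(v | v != h) (D v - 2))%N.
set Y := (\sum_(v | v != h) _)%N => E1 E2 E3.
have [c NE] : exists c, N = (D h + c)%N by exists (N - D h)%N; rewrite subnKC.
(* [c] is the number of vertices not adjacent to [h], other than [h]. The two degree sums give
   [X = c + n3] and this value of [Y]; since [Y <= X] and [D h >= 13], only [c = 0] is possible, and
   then [Y = 0] excludes degree 4. *)
have Yc : (Y + 5 * c = c * (N + D h))%N.
  have sq : (N ^ 2 = D h ^ 2 + c * (N + D h))%N by rewrite NE -!mulnn; ring.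
  by move: S1 S2 E1 E2 NE; rewrite sq /N; move: (c * _)%N (D h ^ 2)%N => a b; lia.
have c0 : c = 0%N.
  case: c NE Yc => [//|c] NE; rewrite [(c.+1 * _)%N]mulSn => Yc; exfalso.
  have : (c * 19 <= c * (N + D h))%N by rewrite leq_mul2l; apply/orP; right; lia.
  move: Yc; move: (c * (N + D h))%N => a Yc ca.
  by move: S1 E1 E3 NE Yc Dh N51; rewrite /N; lia.
have Y0 : Y = 0%N by move: Yc; rewrite c0 mul0n; lia.
have Dh1 : D h = N by rewrite NE c0 addn0.
exists h => // v vh; have := D4' v vh; move/eqP: Y0.
rewrite sum_nat_eq0 => /forall_inP/(_ v vh); have := D2 v.
by case: (D v) => [|[|[|[|[|]]]]].
Qed.

(** * Joins of a vertex with cycles and paths *)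

(** The encoding of [wheel_vert] with the edges replaced by paths of arbitrary orders [k j]; this is
    the shape that a cospectral mate is shown to have. *)
Definition gw_vert (t r : nat) (s : 'I_t -> nat) (k : 'I_r -> nat) : finType :=
  option ({i : 'I_t & 'I_(s i)} + {j : 'I_r & 'I_(k j)}).

Definition path_adj (r : nat) (k : 'I_r -> nat) (u v : {j : 'I_r & 'I_(k j)}) : bool :=
  (tag u == tag v) &&
  (((tagged u).+1 == tagged v)%N || ((tagged v).+1 == tagged u)%N).

Definition gw_adj (t r : nat) (s : 'I_t -> nat) (k : 'I_r -> nat) : rel (gw_vert s k) :=
  fun x y =>
    match x, y with
    | None, None => false
    | None, Some _ => true
    | Some _, None => true
    | Some (inl u), Some (inl v) => cyc_adj u v
    | Some (inr u), Some (inr v) => path_adj u v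
    | _, _ => false
    end.
Arguments gw_adj {t r} s k x y.

Lemma sum_option (R : nmodType) (T : finType) (F : option T -> R) :
  \sum_x F x = F None + \sum_x F (Some x).
Proof.
rewrite (bigD1 None) //=; congr (_ + _).
by rewrite (reindex_omap Some id) //= => [|[x|]//]; apply: eq_bigl => x; rewrite eqxx.
Qed.

Lemma sum_tagged (R : nmodType) (I : finType) (T : I -> finType)
    (F : {i : I & T i} -> R) :
  \sum_x F x = \sum_i \sum_(a : T i) F (Tagged T a).
Proof.
by rewrite (sig_big_dep _ (fun=> predT) (fun i a => F (Tagged T a))) /=; apply: eq_bigr => -[].
Qed.

Lemma adj_sum (V : finType) (e : rel V) (v : V) (l : seq V) (R : nmodType)
    (F : V -> R) :
  uniq l -> (forall w, e v w = (w \in l)) -> \sum_(w | e v w) F w = \sum_(w <- l) F w.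
Proof. by move=> ul el; rewrite big_uniq //; apply: eq_bigl => w; rewrite el. Qed.

Lemma adj_degree (V : finType) (e : rel V) (v : V) (l : seq V) :
  uniq l -> (forall w, e v w = (w \in l)) -> degree e v = size l.
Proof. by move=> ul el; rewrite /degree -(card_uniqP ul); apply: eq_card => w; rewrite !inE el. Qed.

(* Values in [algC] rather than in the regular module [algC^o], so that [ring] applies. *)
Definition ev (V : finType) (u : fvec V) (v : V) : algC := u v.

Lemma evP (V : finType) (u v : fvec V) : u = v <-> forall x, ev u x = ev v x.
Proof. by split=> [->//|H]; apply/ffunP. Qed.

Lemma ev0 (V : finType) (x : V) : ev 0 x = 0. Proof. by rewrite /ev ffunE. Qed.

Lemma evD (V : finType) (u v : fvec V) x : ev (u + v) x = ev u x + ev v x.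
Proof. by rewrite /ev ffunE. Qed.

Lemma evN (V : finType) (u : fvec V) x : ev (- u) x = - ev u x.
Proof. by rewrite /ev ffunE. Qed.

Lemma evZ (V : finType) a (u : fvec V) x : ev (a *: u) x = a * ev u x.
Proof. by rewrite /ev ffunE. Qed.

Lemma ip_ev (V : finType) (u v : fvec V) : ip u v = \sum_x ev u x * (ev v x)^*.
Proof. by []. Qed.

Lemma ev_Qop (V : finType) (e : rel V) (u : fvec V) x :
  ev (Qop e u) x = \sum_(w | e x w) (ev u x + ev u w).
Proof. by rewrite /ev ffunE. Qed.

Section GW.
Variables (t r : nat) (s : 'I_t -> nat) (k : 'I_r -> nat).
Hypotheses (s3 : forall i, (3 <= s i)%N) (k2 : forall j, (2 <= k j)%N).

Local Notation V := (gw_vert s k).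
Local Notation e := (gw_adj s k).

Lemma s_gt0 i : (0 < s i)%N. Proof. exact: leq_trans (s3 i). Qed.
Lemma k_gt0 j : (0 < k j)%N. Proof. exact: leq_trans (k2 j). Qed.

(* Vertices are addressed by natural numbers, reduced modulo the component size. *)
Definition cyn i (m : nat) : V :=
  Some (inl (Tagged (fun i => 'I_(s i)) (Ordinal (ltn_pmod m (s_gt0 i))))).
Definition pan j (m : nat) : V :=
  Some (inr (Tagged (fun j => 'I_(k j)) (Ordinal (ltn_pmod m (k_gt0 j))))).

Lemma cyn_mod i m m' : (m = m' %[mod s i])%N -> cyn i m = cyn i m'.
Proof.
by move=> h; rewrite /cyn; congr (Some (inl (Tagged _ _))); apply: val_inj.
Qed.

Lemma cyn_ord i (a : 'I_(s i)) : cyn i a = Some (inl (Tagged (fun i => 'I_(s i)) a)).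
Proof. by congr (Some (inl (Tagged _ _))); apply: val_inj; rewrite /= modn_small. Qed.

Lemma pan_ord j (a : 'I_(k j)) : pan j a = Some (inr (Tagged (fun i => 'I_(k i)) a)).
Proof. by congr (Some (inr (Tagged _ _))); apply: val_inj; rewrite /= modn_small. Qed.

(** Cycle vertices are presented as successors [m.+1], so that their neighbours are [m] and [m.+2]
    and no cyclic predecessor is ever written. *)
Lemma gw_case (P : V -> Prop) : P None -> (forall i m, P (cyn i m.+1)) ->
  (forall j m, (m < k j)%N -> P (pan j m)) -> forall v, P v.
Proof.
move=> PN Pc Pp [[[i a]|[j b]]|//].
  have -> : Some (inl (existT _ i a)) = cyn i (a + s i).-1.+1 :> V.
    rewrite -[LHS]cyn_ord; apply: cyn_mod; rewrite prednK ?modnDr //.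
    by have := s_gt0 i; lia.
  exact: Pc.
by have := Pp j b (ltn_ord b); rewrite pan_ord.
Qed.

Lemma cyn_eq i m m' : (cyn i m == cyn i m') = (m == m' %[mod s i])%N.
Proof.
apply/eqP/eqP => [|/cyn_mod//].
by move/(congr1 (fun v : V => if v is Some (inl x) then tagged x : nat else 0%N)).
Qed.

Lemma pan_eq j m m' : (m < k j)%N -> (m' < k j)%N -> (pan j m == pan j m') = (m == m').
Proof.
move=> h h'; apply/eqP/eqP => [|->//].
move/(congr1 (fun v : V => if v is Some (inr x) then tagged x : nat else 0%N)).
by rewrite /= !modn_small.
Qed.

Definition cyn_nbr i m : seq V := [:: None; cyn i m; cyn i m.+2].
Definition pan_nbr j m : seq V :=
  None :: (if (0 < m)%N then [:: pan j m.-1] else [::]) ++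
          (if (m.+1 < k j)%N then [:: pan j m.+1] else [::]).

Lemma cyn_nbr_uniq i m : uniq (cyn_nbr i m).
Proof.
rewrite /= !inE /= andbT cyn_eq -(addn2 m) -{1}(addn0 m) eqn_modDl mod0n.
by rewrite modn_small ?(s3 i) //; exact: leq_trans (s3 i).
Qed.

Lemma cyn_nbrP i m v : e (cyn i m.+1) v = (v \in cyn_nbr i m).
Proof.
have s1 := s_gt0 i.
case: v => [[[i' a]|x]|]; rewrite ?inE //=.
rewrite /cyc_adj /=; have [ii'|ii'] := eqVneq i i'; last first.
  by rewrite /=; apply/esym/norP; split; apply/eqP => -[] E; rewrite E eqxx in ii'.
subst i'; rewrite -[Some (inl (existT _ i a))]/(Some (inl (Tagged (fun i => 'I_(s i)) a))).
rewrite -!cyn_ord !cyn_eq /= orbC; congr (_ || _).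
  by rewrite -[a.+1]addn1 -[m.+1]addn1 eqn_modDr.
by rewrite -addn1 modnDml addn1 [(a %% _)%N]modn_small // eq_sym.
Qed.

Lemma pan_nbr_uniq j m : (m < k j)%N -> uniq (pan_nbr j m).
Proof.
move=> mk; rewrite /pan_nbr; case: ltnP => // m0; case: ltnP => //= mk1.
rewrite !inE /= pan_eq //; last by lia.
by rewrite andbT; apply/eqP; lia.
Qed.

Lemma pan_nbrP j m v : (m < k j)%N -> e (pan j m) v = (v \in pan_nbr j m).
Proof.
move=> mk; case: v => [[x|[j' b]]|]; rewrite ?inE //=.
  by case: ifP => _; case: ifP => _; rewrite ?inE.
rewrite /path_adj /=; have [jj'|jj'] := eqVneq j j'; last first.
  rewrite /= mem_cat; apply/esym/norP; split; case: ifP => // _; rewrite inE;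
    by apply/eqP => -[] E; rewrite E eqxx in jj'.
subst j'; rewrite -[Some (inr (existT _ j b))]/(Some (inr (Tagged (fun i => 'I_(k i)) b))).
have bk := ltn_ord b; rewrite -pan_ord /= modn_small // mem_cat orbC; congr (_ || _).
  case: ltnP => m0; first by rewrite inE pan_eq //; lia.
  by rewrite in_nil; apply/eqP; lia.
case: ltnP => m1; first by rewrite inE pan_eq // eq_sym.
by rewrite in_nil; apply/eqP; lia.
Qed.

Lemma gw_simple : simple_graph e.
Proof.
split=> [x y|x].
  case: x y => [[[i a]|[j b]]|] [[[i' a']|[j' b']]|] //=.
    rewrite /cyc_adj /= [i' == i]eq_sym; have [E|//] := eqVneq i i'.
    by subst i'; rewrite /= orbC.
  by rewrite /path_adj /= [j' == j]eq_sym orbC.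
case: x => [[[i a]|[j b]]|] //=.
  rewrite /cyc_adj /= eqxx orbb /=; apply/eqP => E; have sa := ltn_ord a; have := s3 i.
  move: E; have [aS|] := ltnP a.+1 (s i); first by rewrite modn_small //; lia.
  move=> h; have -> : a.+1 = s i by lia.
  by rewrite modnn; lia.
by rewrite /path_adj /= orbb eqxx /=; apply/eqP; lia.
Qed.

Lemma gw_sum (R : nmodType) (F : V -> R) :
  \sum_v F v = F None + \sum_i \sum_(a < s i) F (cyn i a) + \sum_j \sum_(b < k j) F (pan j b).
Proof.
rewrite sum_option big_sumType /= addrA; congr (_ + _ + _); rewrite sum_tagged.
  by apply: eq_bigr => i _; apply: eq_bigr => a _; rewrite cyn_ord.
by apply: eq_bigr => i _; apply: eq_bigr => a _; rewrite pan_ord.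
Qed.

Lemma gw_sum_nat (F : V -> nat) :
  (\sum_v F v =
   F None + \sum_i \sum_(a < s i) F (cyn i a) + \sum_j \sum_(b < k j) F (pan j b))%N.
Proof. exact: gw_sum. Qed.

Definition ncyc := (\sum_i s i)%N.
Definition npath := (\sum_j k j)%N.

Lemma card_gw : #|V| = (1 + ncyc + npath)%N.
Proof.
have -> : #|V| = (\sum_(v : V) 1)%N by rewrite sum1_card.
rewrite gw_sum_nat; congr (_ + _ + _)%N; apply: eq_bigr => i _;
  by rewrite sum1_card card_ord.
Qed.

Section Qgw.
Variable u : fvec V.
Local Notation z := (ev u None).

Lemma Qop_cyn i m : ev (Qop e u) (cyn i m.+1) =
  3 * ev u (cyn i m.+1) + ev u (cyn i m) + ev u (cyn i m.+2) + z.
Proof.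
rewrite ev_Qop (adj_sum _ (cyn_nbr_uniq i m) (cyn_nbrP i m)) !big_cons big_nil.
by ring.
Qed.

Lemma Qop_pan j m : (m < k j)%N -> ev (Qop e u) (pan j m) =
  ev u (pan j m) + z +
  (if (0 < m)%N then ev u (pan j m) + ev u (pan j m.-1) else 0) +
  (if (m.+1 < k j)%N then ev u (pan j m) + ev u (pan j m.+1) else 0).
Proof.
move=> mk; rewrite ev_Qop (adj_sum _ (pan_nbr_uniq mk) (fun v => pan_nbrP v mk)).
rewrite big_cons big_cat /= addrA.
by do 2![case: ifP => _]; rewrite ?big_cons !big_nil ?addr0.
Qed.

Lemma Qop_hub : ev (Qop e u) None = (ncyc + npath)%:R * z +
  \sum_i \sum_(a < s i) ev u (cyn i a) + \sum_j \sum_(b < k j) ev u (pan j b).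
Proof.
rewrite ev_Qop big_mkcond gw_sum /= add0r natrD mulrDl.
have E (I : finType) (n : I -> nat) (g : forall i, nat -> algC) :
   \sum_i \sum_(a < n i) (z + g i a) = (\sum_i n i)%:R * z + \sum_i \sum_(a < n i) g i a.
  rewrite natr_sum mulr_suml -big_split /=; apply: eq_bigr => i _.
  by rewrite big_split /= sumr_const card_ord mulr_natl.
by rewrite (E _ s (fun i a => ev u (cyn i a))) (E _ k (fun i a => ev u (pan i a))) addrACA addrA.
Qed.

(** In an eigenvalue [1 + y] the 1 absorbs the contribution of the hub edge to the degree. What
    remains are the equations of the bare cycles and paths at [y], coupled by the hub entry [z]. *)
Lemma Espace_gwP y : u \in Espace e (1 + y) <->
  [/\ forall i m, ev u (cyn i m) + ev u (cyn i m.+2) + z = (y - 2) * ev u (cyn i m.+1),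
      forall j m, (m < k j)%N -> z +
        (if (0 < m)%N then ev u (pan j m) + ev u (pan j m.-1) else 0) +
        (if (m.+1 < k j)%N then ev u (pan j m) + ev u (pan j m.+1) else 0)
        = y * ev u (pan j m)
    & (ncyc + npath)%:R * z + \sum_i \sum_(a < s i) ev u (cyn i a) +
      \sum_j \sum_(b < k j) ev u (pan j b) = (1 + y) * z].
Proof.
have evl (a b c d : algC) : a - b = c - d -> a = b <-> c = d.
  move=> E; split=> /eqP; rewrite -subr_eq0; [rewrite E|rewrite -E];
    by rewrite subr_eq0 => /eqP.
split=> [/EspaceP/evP Q|[Ec Ep E0]].
  have {}Q v : ev (Qop e u) v = (1 + y) * ev u v by rewrite Q evZ.
  split=> [i m|j m mk|].
  - by apply: (evl _ _ _ _ _).2 (Q (cyn i m.+1)); rewrite Qop_cyn; ring.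
  - by apply: (evl _ _ _ _ _).2 (Q (pan j m)); rewrite Qop_pan //; ring.
  - by rewrite -Qop_hub Q.
apply/EspaceP/evP; apply: gw_case => [|i m|j m mk]; rewrite evZ.
- by rewrite Qop_hub.
- by apply: (evl _ _ _ _ _).1 (Ec i m); rewrite Qop_cyn; ring.
- by apply: (evl _ _ _ _ _).1 (Ep j m mk); rewrite Qop_pan //; ring.
Qed.

End Qgw.

Lemma degree_cyn i m : degree e (cyn i m.+1) = 3%N.
Proof. by rewrite (adj_degree (cyn_nbr_uniq i m) (cyn_nbrP i m)). Qed.

Lemma degree_cyn_ord i (a : 'I_(s i)) : degree e (cyn i a) = 3%N.
Proof.
have -> : cyn i a = cyn i (a + s i).-1.+1.
  by apply: cyn_mod; rewrite prednK ?modnDr //; have := s_gt0 i; lia.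
exact: degree_cyn.
Qed.

Lemma degree_pan j m : (m < k j)%N ->
  degree e (pan j m) = (1 + (0 < m) + (m.+1 < k j))%N.
Proof.
move=> mk; rewrite (adj_degree (pan_nbr_uniq mk) (fun v => pan_nbrP v mk)) /= size_cat.
by case: ifP; case: ifP.
Qed.

Lemma degree_hub : degree e None = (ncyc + npath)%N.
Proof.
rewrite /degree (eq_card (B := predC1 None)) => [|[x|]//].
by rewrite cardC1 card_gw.
Qed.

Lemma path_degree_sum n : (2 <= n)%N ->
  (\sum_(b < n) (1 + (0 < b) + (b.+1 < n)) + 2 = 3 * n)%N.
Proof.
case: n => [//|[//|n]] _; rewrite !big_split /=.
have -> : (\sum_(b < n.+2) (0 < b) = n.+1)%N.
  by rewrite big_ord_recl /= (eq_bigr (fun=> 1%N)) // sum_nat_const card_ord muln1.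
have -> : (\sum_(b < n.+2) (b.+1 < n.+2) = n.+1)%N.
  rewrite big_ord_recr /= ltnn addn0 (eq_bigr (fun=> 1%N)) ?sum_nat_const ?card_ord ?muln1 //.
  by move=> b _; rewrite /= ltnS (ltn_ord b).
by rewrite sum_nat_const card_ord; lia.
Qed.

(** Each path falls short by 2 because of its two ends; with the order fixed, the trace therefore
    reveals the number [r] of paths. *)
Lemma degree_sum_gw : (\sum_v degree e v + 2 * r = 4 * (ncyc + npath))%N.
Proof.
rewrite gw_sum_nat degree_hub; set A := (\sum_i _)%N; set B := (\sum_j _)%N.
have -> : A = (3 * ncyc)%N.
  rewrite /A /ncyc big_distrr /=; apply: eq_bigr => i _.
  rewrite (eq_bigr (fun=> 3%N)) ?sum_nat_const ?card_ord 1?mulnC // => a _.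
  exact: degree_cyn_ord.
have : (B + 2 * r = 3 * npath)%N.
  have -> : (2 * r = \sum_(j < r) 2)%N by rewrite sum_nat_const card_ord mulnC.
  rewrite /B /npath big_distrr -big_split /=; apply: eq_bigr => j _.
  rewrite (eq_bigr (fun b : 'I_(k j) => 1 + (0 < b) + (b.+1 < k j)))%N; last first.
    by move=> b _; rewrite degree_pan.
  by rewrite path_degree_sum.
move: (ncyc) (npath) => a b; lia.
Qed.

End GW.

(** * Multiplicities *)

Lemma rec2_zero (F : nat -> algC) (c : algC) :
  (forall m, F m + F m.+2 = c * F m.+1) -> F 0%N = 0 -> F 1%N = 0 -> forall m, F m = 0.
Proof.
move=> rec F0 F1 m; suff [] : F m = 0 /\ F m.+1 = 0 by [].
elim: m => [|m [IH1 IH2]] //; split=> //.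
by have := rec m; rewrite IH1 IH2 mulr0 add0r.
Qed.

(* [F m.+1 - w * F m] is geometric of ratio [w^-1]. *)
Lemma rec2_periodic (F : nat -> algC) (w : algC) n :
  w != 0 -> w ^+ n != 1 -> (forall m, F (m + n)%N = F m) ->
  (forall m, F m + F m.+2 = (w + w^-1) * F m.+1) -> forall m, F m = 0.
Proof.
move=> w0 wn per rec.
have geo m : F m.+1 - w * F m = w ^- m * (F 1%N - w * F 0%N).
  elim: m => [|m IH]; first by rewrite expr0 invr1 mul1r.
  rewrite exprS invfM -mulrA -IH; have := rec m => /(canRL (addKr _)) ->.
  by field.
have wn' : w ^- n != 1 by rewrite invr_eq1.
have lin x y : x = y * x -> y != 1 -> x = 0 :> algC.
  move=> E y1; apply/eqP; have : (y - 1) * x == 0 by rewrite mulrBl mul1r -E subrr.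
  by rewrite mulf_eq0 subr_eq0 (negbTE y1).
have g0 : F 1%N - w * F 0%N = 0.
  apply: (lin _ (w ^- n)) => //; rewrite -geo -[n]add0n per -addSn per //.
have F1 m : F m = w ^+ m * F 0%N.
  elim: m => [|m IH]; first by rewrite expr0 mul1r.
  have := geo m; rewrite g0 mulr0 => /eqP; rewrite subr_eq0 => /eqP ->.
  by rewrite IH exprS mulrA.
have F00 : F 0%N = 0 by apply: (lin _ (w ^+ n)) => //; rewrite -F1 -{1}(per 0%N).
by move=> m; rewrite F1 F00 mulr0.
Qed.

Section Dim.
Variables (t r : nat) (s : 'I_t -> nat) (k : 'I_r -> nat).
Hypotheses (s3 : forall i, (3 <= s i)%N) (k2 : forall j, (2 <= k j)%N).

Local Notation V := (gw_vert s k).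
Local Notation e := (gw_adj s k).
Local Notation cyn := (cyn k s3).
Local Notation pan := (pan s k2).

Lemma sum_cyc_const (u : fvec V) (x : algC) : (forall i m, ev u (cyn i m) = x) ->
  \sum_i \sum_(a < s i) ev u (cyn i a) = (ncyc s)%:R * x.
Proof.
move=> H; rewrite /ncyc natr_sum mulr_suml; apply: eq_bigr => i _.
under eq_bigr => a _ do rewrite H.
by rewrite sumr_const card_ord mulr_natl.
Qed.

Variables (w y : algC).
Hypotheses (w0 : w != 0) (w1 : w ^+ 2 != 1) (yE : y = 2 + w + w^-1).

Let w_neq1 : w != 1.
Proof. by apply: contraNneq w1 => ->; rewrite expr1n. Qed.

Lemma y_neq4 : y - 4 != 0.
Proof.
have -> : y - 4 = (w - 1) ^+ 2 / w by rewrite yE; field.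
by rewrite mulf_neq0 ?invr_eq0 // expf_neq0 // subr_eq0.
Qed.

(** The constant [z / (y - 4)] solves the inhomogeneous cycle equations, [z] being the hub entry;
    subtracting it leaves the recurrence with solutions [w^m] and [w^-m]. *)
Lemma cyn_shift_rec (u : fvec V) : u \in Espace e (1 + y) -> forall i m,
  (ev u (cyn i m) - ev u None / (y - 4)) + (ev u (cyn i m.+2) - ev u None / (y - 4)) =
  (w + w^-1) * (ev u (cyn i m.+1) - ev u None / (y - 4)).
Proof.
move=> /(Espace_gwP s3 k2)[Ec _ _] i m; have := Ec i m => /(canRL (addrK _)).
move=> E; have y4 := y_neq4.
have -> : w + w^-1 = y - 2 by rewrite yE; ring.
have -> : (y - 2) * (ev u (cyn i m.+1) - ev u None / (y - 4)) =
   (y - 2) * ev u (cyn i m.+1) - (y - 2) * (ev u None / (y - 4)) by ring.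
rewrite -[(y - 2) * ev u _](addrK (ev u None)) -/(_ - _).
have -> : (y - 2) * (ev u None / (y - 4)) = ev u None + 2 * (ev u None / (y - 4)).
  by field.
by rewrite -(Ec i m); ring.
Qed.

(** The cycles around which [w^a] closes up. *)
Definition resonant : pred 'I_t := [pred i | w ^+ s i == 1].

(** Rank-nullity for the map reading the first two shifted entries on every resonant cycle. There
    the shifted solution is determined by these two entries, which may be prescribed freely; on the
    other cycles it vanishes by periodicity. The kernel [K] consists of the eigenvectors constant on
    the cycles. *)
Lemma gw_dim : exists2 K : {vspace fvec V},
  forall u, (u \in K) <-> (u \in Espace e (1 + y) /\
     forall i m, ev u (cyn i m) = ev u None / (y - 4))
  & \dim (Espace e (1 + y)) = (\dim K + 2 * #|resonant|)%N.
Proof.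
pose I : finType := ({i | resonant i} * bool)%type.
pose f (u : fvec V) : fvec I :=
  [ffun p : I => ev u (cyn (val p.1) p.2) - ev u None / (y - 4)].
have lf : linear f.
  move=> a u v; apply/evP => p; rewrite evD evZ.
  have evf x : ev (f x) p = ev x (cyn (val p.1) p.2) - ev x None / (y - 4).
    by rewrite {1}/ev ffunE.
  by rewrite !evf !evD !evZ; ring.
pose F : {linear fvec V -> fvec I} := HB.pack f (GRing.isLinear.Build _ _ _ _ f lf).
exists (Espace e (1 + y)%R :&: lker (linfun F))%VS.
  move=> u; rewrite memv_cap [u \in lker (linfun F)]memv_ker lfunE /=; split.
    move=> /andP[uE /eqP fu]; split=> // i m.
    apply/eqP; rewrite -subr_eq0; apply/eqP.
    have rec := cyn_shift_rec uE i.
    have [ri|ri] := boolP (resonant i); last first.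
      apply: (rec2_periodic (n := s i) (F := fun m => ev u (cyn i m) - _) w0 ri _ rec).
      by move=> m'; congr (ev u _ - _); apply: cyn_mod; rewrite modnDr.
    have f0 b : ev u (cyn i (nat_of_bool b)) - ev u None / (y - 4) = 0.
      have := congr1 (fun g : fvec I => ev g (exist _ i ri, b)) fu.
      by rewrite ev0 /ev !ffunE.
    exact: (rec2_zero (F := fun m => ev u (cyn i m) - _) rec (f0 false) (f0 true)).
  move=> [uE H]; rewrite uE; apply/eqP/ffunP => p; rewrite !ffunE H.
  by rewrite subrr.
rewrite -(limg_ker_dim (linfun F)); congr (_ + _)%N.
have -> : (linfun F @: Espace e (1 + y)%R)%VS = fullv.
  apply/eqP; rewrite eqEsubv subvf /=; apply/subvP => g _.
  pose al i (c : bool) : algC := ev g (i, c).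
  pose D := w - w^-1.
  have D0 : D != 0.
    have -> : D = (w ^+ 2 - 1) / w by rewrite /D; field.
    by rewrite mulf_neq0 ?invr_eq0 ?subr_eq0.
  (* [A] and [B] solve [A + B = al i false] and [A w + B w^-1 = al i true], a system of determinant
     [-D]; the booleans stand for the positions 0 and 1. *)
  pose A i : algC := (al i true - al i false / w) / D.
  pose B i : algC := (al i false * w - al i true) / D.
  pose c i m : algC := if @insub _ resonant _ i is Some i' then
     A i' * w ^+ m + B i' * w^-1 ^+ m else 0.
  pose uf (v : V) : algC := if v is Some (inl x) then c (tag x) (tagged x) else 0.
  pose u : fvec V := [ffun v => uf v].
  have uc i m : ev u (cyn i m) = c i m.
    rewrite /ev ffunE /= /c; case: insubP => // i' ri _.
    have ri1 : w ^+ s i = 1 by apply/eqP.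
    by rewrite !expr_mod // exprVn ri1 invr1.
  have up j m : ev u (pan j m) = 0 by rewrite /ev ffunE.
  have uN : ev u None = 0 by rewrite /ev ffunE.
  have uE : u \in Espace e (1 + y).
    apply/(Espace_gwP s3 k2); split=> [i m|j m mk|].
    - rewrite !uc uN addr0 /c; case: insubP => [i' ri _|_]; last by rewrite mulr0 addr0.
      by rewrite yE !exprS; field.
    - by rewrite !up uN !addr0 !if_same mulr0 !addr0.
    rewrite uN !mulr0 add0r [X in _ + X]big1 ?addr0; last first.
      by move=> j _; rewrite big1 // => b _; rewrite up.
    apply: big1 => i _; under eq_bigr => a _ do rewrite uc.
    rewrite /c; case: insubP => [i' /eqP ri _|_]; last by rewrite big1.
    (* The entries sum to zero around each resonant cycle, so the hub equation holds with hub entry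
       0. *)
    have geo x : x != 1 -> x ^+ s i = 1 -> \sum_(a < s i) x ^+ a = 0 :> algC.
      move=> x1 xs; have := subrX1 x (s i); rewrite xs subrr => /esym/eqP.
      by rewrite mulf_eq0 subr_eq0 (negbTE x1) => /eqP.
    rewrite big_split /= -!mulr_sumr !geo ?mulr0 ?addr0 //.
      by rewrite invr_eq1.
    by rewrite exprVn ri invr1.
  suff <- : linfun F u = g by apply: memv_img.
  rewrite lfunE /=; apply/ffunP => -[i b]; rewrite ffunE /= uN mul0r subr0 uc /c.
  rewrite insubT ?(valP i) //= => ri; have -> : Sub (\val i) ri = i by apply: val_inj.
  have E0 : A i + B i = al i false.
    transitivity (al i false * (D / D)); first by rewrite /A /B /D; ring.
    by rewrite mulfV // mulr1.
  have E1 : A i * w + B i * w^-1 = al i true.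
    transitivity (al i true * (D / D)); last by rewrite mulfV // mulr1.
    have : w * w^-1 = 1 by rewrite mulfV.
    rewrite /A /B; set x := w^-1; set d := D^-1 => wx.
    have -> : (al i true - al i false * x) * d * w + (al i false * w - al i true) * d * x =
      al i true * ((w - x) * d) - al i false * d * (w * x) + al i false * d * (w * x) by ring.
    by rewrite subrK.
  by case: b; rewrite /= ?expr0 ?expr1 ?mulr1 ?E0 ?E1.
by rewrite dim_fvec card_prod card_bool card_sig mulnC.
Qed.

End Dim.

(** [w] is a root of [X^2 - (y - 2) X + 1], whose roots have product 1. *)
Lemma joukowski (y : algC) : exists2 w : algC, w != 0 & y = 2 + w + w^-1.
Proof.
set c := y - 2; set d := sqrtC (c ^+ 2 - 4); pose w := (c + d) / 2.
have dd : d ^+ 2 = c ^+ 2 - 4 by rewrite sqrtCK.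
have ww : w * (c - w) = 1.
  rewrite /w; transitivity ((c ^+ 2 - d ^+ 2) / 4); first by field.
  by rewrite dd; field.
have w0 : w != 0.
  by apply: contra_eq_neq ww => ->; rewrite mul0r eq_sym oner_eq0.
exists w => //; have -> : w^-1 = c - w by apply: (mulfI w0); rewrite ww mulfV.
by rewrite /c; ring.
Qed.

Lemma joukowski_sqr_neq1 (w y : algC) : y = 2 + w + w^-1 -> y != 0 -> y != 4 ->
  w ^+ 2 != 1.
Proof.
move=> yE /eqP y0 /eqP y4; apply/negP; rewrite sqrf_eq1 => /orP[]/eqP wE.
  by apply: y4; rewrite yE wE invr1; ring.
by apply: y0; rewrite yE wE invrN1; ring.
Qed.

Lemma root_unity_inv (w : algC) n : (0 < n)%N -> w ^+ n = 1 -> w^-1 = w^*.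
Proof.
move=> n0 wn; have w1 : `|w| = 1.
  apply/eqP; rewrite -(@pexpr_eq1 _ `|w| n) //.
  by rewrite -normrX wn normr1.
by rewrite invC_norm w1 expr1n invr1 mul1r.
Qed.

(** As [w^-1] is the conjugate of [w], [y] is the square of [|1 + w|] and [4 - y] that of
    [|1 - w|]. *)
Lemma root_unity_bounds (w y : algC) n : (0 < n)%N -> w ^+ n = 1 ->
  y = 2 + w + w^-1 -> 0 <= y <= 4.
Proof.
move=> n0 wn yE; have wi := root_unity_inv n0 wn.
have w0 : w != 0 by apply: contra_eq_neq wn => ->; rewrite expr0n gtn_eqF // eq_sym oner_eq0.
have ww : w * w^-1 = 1 by rewrite mulfV.
have E1 : y = `|1 + w| ^+ 2.
  rewrite normCK rmorphD rmorph1 /= -wi yE.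
  have -> : (1 + w) * (1 + w^-1) = 1 + w + w^-1 + w * w^-1 by ring.
  by rewrite ww; ring.
have E2 : 4 - y = `|1 - w| ^+ 2.
  rewrite normCK rmorphB rmorph1 /= -wi yE.
  have -> : (1 - w) * (1 - w^-1) = 1 - w - w^-1 + w * w^-1 by ring.
  by rewrite ww; ring.
by rewrite {1}E1 exprn_ge0 //= -subr_ge0 E2 exprn_ge0.
Qed.

(** * The given graph: eigenvalues below 2 and above 5 *)

Section CyclesAndEdges.
Variables (t q : nat) (s : 'I_t -> nat).
Hypothesis s3 : forall i, (3 <= s i)%N.
Let k2 (j : 'I_q) : (2 <= 2)%N := isT.

Local Notation V := (gw_vert s (fun _ : 'I_q => 2%N)).
Local Notation e := (gw_adj s (fun _ : 'I_q => 2%N)).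
Local Notation cyn := (cyn (fun _ : 'I_q => 2%N) s3).
Local Notation pan := (pan s k2).

Lemma npath2 : npath (fun _ : 'I_q => 2%N) = (2 * q)%N.
Proof. by rewrite /npath sum_nat_const card_ord mulnC. Qed.

Lemma K2_entries (y : algC) (u : fvec V) : u \in Espace e (1 + y) -> y != 0 ->
  forall j m, (m < 2)%N -> (y - 2) * ev u (pan j m) = ev u None.
Proof.
move=> /(Espace_gwP s3 k2)[_ Ep _] y0 j.
have := Ep j 0%N isT; have := Ep j 1%N isT; rewrite /= addr0 addr0 => E1 E0.
have E : ev u (pan j 1) = ev u (pan j 0).
  apply: (mulfI y0); rewrite -E0 -E1; ring.
have E2 : (y - 2) * ev u (pan j 0) = ev u None.
  rewrite mulrBl -E0 E; ring.
by case=> [|[|//]] _; rewrite ?E.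
Qed.

(** The hub equation per unit of hub entry, when the entries are [z / (y - 4)] on cycles and
    [z / (y - 2)] on edges: a secular function of the coupling. *)
Definition bracket (y : algC) : algC :=
  (ncyc s + 2 * q)%:R - 1 - y + (ncyc s)%:R / (y - 4) + (2 * q)%:R / (y - 2).

Lemma bracket_root (y : algC) (u : fvec V) : u \in Espace e (1 + y) ->
  y != 0 -> y != 2 -> (forall i m, ev u (cyn i m) = ev u None / (y - 4)) ->
  ev u None * bracket y = 0.
Proof.
move=> uE y0 y2 uc; have up := K2_entries uE y0.
have y2' : y - 2 != 0 by rewrite subr_eq0.
have {}up j m : (m < 2)%N -> ev u (pan j m) = ev u None / (y - 2).
  by move=> m2; rewrite -(up j m m2); field.
have [_ _] := (Espace_gwP s3 k2 u y).1 uE.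
rewrite (sum_cyc_const uc) npath2.
have -> : \sum_(j < q) \sum_(b < 2) ev u (pan j b) = (2 * q)%:R * (ev u None / (y - 2)).
  rewrite (eq_bigr (fun=> 2%:R * (ev u None / (y - 2)))).
    by rewrite sumr_const card_ord -mulrnAl natrM mulr_natr.
  by move=> j _; rewrite !big_ord_recr big_ord0 /= !up //; ring.
move=> E; rewrite /bracket natrD in E *.
transitivity ((((ncyc s)%:R + (2 * q)%:R) * ev u None + (ncyc s)%:R * (ev u None / (y - 4)) +
   (2 * q)%:R * (ev u None / (y - 2))) - (1 + y) * ev u None); first by ring.
by rewrite E subrr.
Qed.

Hypothesis n3_gt3 : (3 < ncyc s)%N.

(** Below 1 the two fractions are at least [-n3 / 3] and [-2q], with n3 the number of cycle
    vertices. The rest is at least [(1 - y) + (2 n3 / 3 - 2)], positive as n3 exceeds 3. *)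
Lemma bracket_gt0 (y : algC) : y \is Num.real -> y < 1 -> 0 < bracket y.
Proof.
move=> yr y1.
have y4 : 0 < 4 - y by rewrite subr_gt0; apply: lt_trans y1 _; rewrite ltr1n.
have y2 : 0 < 2 - y by rewrite subr_gt0; apply: lt_trans y1 _; rewrite ltr1n.
have i4 : (4 - y)^-1 <= 3^-1.
  rewrite lef_pV2 ?posrE // ?ltr0n //.
  by have -> : 4 - y = 3 + (1 - y); [ring | rewrite lerDl subr_ge0 ltW].
have i2 : (2 - y)^-1 <= 1.
  rewrite invf_le1 //.
  by have -> : 2 - y = 1 + (1 - y); [ring | rewrite lerDl subr_ge0 ltW].
have -> : bracket y = (1 - y) + ((ncyc s)%:R * (2 / 3) - 2) +
   (ncyc s)%:R * (3^-1 - (4 - y)^-1) + (2 * q)%:R * (1 - (2 - y)^-1).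
  rewrite /bracket natrD -[y - 4]opprB -[y - 2]opprB !invrN.
  by move: (4 - y)^-1 (2 - y)^-1 => a b; field.
do 2 (apply: ltr_pwDl; last by rewrite mulr_ge0 // subr_ge0).
apply: ltr_pwDl; first by rewrite subr_gt0.
rewrite subr_ge0; apply: (@le_trans _ _ (3 * (2 / 3))).
  by have -> : 3 * (2 / 3) = 2 :> algC by field.
by rewrite ler_pM2r ?ler_nat ?divr_gt0 ?ltr0n // ltnW.
Qed.

(** The secular function has no zero below 1, so the hub entry vanishes and with it [K]. Only
    resonant cycles contribute, which makes the multiplicity even. *)
Lemma fw_dim (y w : algC) : y \is Num.real -> y < 1 -> y != 0 -> w != 0 ->
  y = 2 + w + w^-1 -> \dim (Espace e (1 + y)) = (2 * #|resonant s w|)%N.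
Proof.
move=> yr y1 y0 w0 yE.
have y_lt (m : nat) : (1 <= m)%N -> y != m%:R.
  by move=> m1; rewrite lt_eqF //; apply: lt_le_trans y1 _; rewrite ler1n.
have w1 : w ^+ 2 != 1 := joukowski_sqr_neq1 yE y0 (y_lt 4%N isT).
have [K KP ->] := gw_dim s3 k2 w0 w1 yE.
suff -> : K = 0%VS by rewrite dimv0 add0n.
apply/vspaceP => u; rewrite memv0; apply/idP/eqP => [/KP[uE uc]|->]; last exact: mem0v.
have := bracket_root uE y0 (y_lt 2%N isT) uc.
move/eqP; rewrite mulf_eq0 (gt_eqF (bracket_gt0 yr y1)) orbF => /eqP z0.
apply/evP; apply: (@gw_case _ _ _ (fun=> 2%N) s3 k2) => [|i m|j m m2]; rewrite ev0 //.
  by rewrite uc z0 mul0r.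
have := K2_entries uE y0 j m2; rewrite z0 => /eqP.
by rewrite mulf_eq0 subr_eq0 (negbTE (y_lt 2%N isT)) => /eqP.
Qed.

Lemma resonant0 (w y : algC) : y = 2 + w + w^-1 -> ~~ (0 <= y <= 4) -> #|resonant s w| = 0%N.
Proof.
move=> yE yn; apply: eq_card0 => i; rewrite inE; apply/negP => /eqP wi.
by move/negP: yn; apply; apply: root_unity_bounds wi yE; exact: leq_trans (s3 i).
Qed.

Variables (lam : V -> algC) (phi : V -> fvec V).
Hypothesis eb : eigenbasis e lam phi.

(** For [y < 0] no root of unity [w] gives [y], so no cycle is resonant and the eigenspace is
    zero. *)
Lemma fw_eig_ge1 i : 1 <= lam i.
Proof.
have lr := eb_real eb i; rewrite real_leNgt ?realn //; apply/negP => l1.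
pose y := lam i - 1; have lE : lam i = 1 + y by rewrite /y; ring.
have yn : y < 0 by rewrite subr_lt0.
have [w w0 yE] := joukowski y.
have := eigenbasis_mem eb i; rewrite lE => /[dup] phiE.
have : \dim (Espace e (1 + y)) = 0%N.
  rewrite (fw_dim (ltr0_real yn) (lt_trans yn ltr01) _ w0 yE) ?lt_eqF //.
  by rewrite (resonant0 yE) // (lt_geF yn).
move/eqP; rewrite dimv_eq0 => /eqP ->; rewrite memv0.
by rewrite (negbTE (eigenbasis_neq0 eb i)).
Qed.

(* Eigenvectors for eigenvalues above 5 are multiples of positive vectors,
   so two of them cannot be orthogonal. *)
Lemma fw_eig_gt5 i j : 5 < lam i -> 5 < lam j -> i = j.
Proof.
pose g (p : algC * algC) (v : V) : algC :=
  if v is Some x then if x is inl _ then p.1 else p.2 else 1.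
have shape i0 : 5 < lam i0 -> exists2 p : algC * algC, 0 <= p.1 /\ 0 <= p.2 &
    ev (phi i0) None != 0 /\ forall v : V, ev (phi i0) v = ev (phi i0) None * g p v.
  move=> l5; set u := phi i0; pose y := lam i0 - 1.
  have lE : lam i0 = 1 + y by rewrite /y; ring.
  have y4 : 4 < y by rewrite ltrBrDr natr1.
  have yn (m : nat) : (m <= 4)%N -> y != m%:R.
    by move=> m4; rewrite gt_eqF //; apply: le_lt_trans y4; rewrite ler_nat.
  have [w w0 yE] := joukowski y.
  have w1 := joukowski_sqr_neq1 yE (yn 0%N isT) (yn 4%N isT).
  have y40 : y - 4 != 0 by rewrite subr_eq0 yn.
  have y20 : y - 2 != 0 by rewrite subr_eq0 yn.
  have uE : u \in Espace e (1 + y) by rewrite -lE; apply: eigenbasis_mem.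
  have uc i1 m : ev u (cyn i1 m) = ev u None / (y - 4).
    apply/eqP; rewrite -subr_eq0; apply/eqP.
    have /= := @rec2_periodic (fun m => ev u (cyn i1 m) - _) w (s i1) w0 _ _
       (cyn_shift_rec s3 k2 w0 w1 yE uE i1) m.
    apply=> [|m']; last by congr (ev u _ - _); apply: cyn_mod; rewrite modnDr.
    have := resonant0 yE; have -> : (0 <= y <= 4) = false.
      by rewrite (lt_geF y4) andbF.
    by move=> /(_ isT)/card0_eq/(_ i1); rewrite inE => ->.
  have up j1 m : (m < 2)%N -> ev u (pan j1 m) = ev u None / (y - 2).
    by move=> m2; rewrite -(K2_entries uE (yn 0%N isT) j1 m2); field.
  have shp : forall v : V, ev u v = ev u None * g ((y - 4)^-1, (y - 2)^-1) v.
    by apply: (@gw_case _ _ _ (fun=> 2%N) s3 k2) => [|i1 m|j1 m m2] /=; rewrite ?mulr1 // ?uc ?up.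
  exists ((y - 4)^-1, (y - 2)^-1) => /=.
    rewrite !invr_ge0 !subr_ge0 (ltW y4); split=> //.
    by apply: le_trans (ltW y4); rewrite ler_nat.
  split=> //; apply/eqP => z0; have := eigenbasis_neq0 eb i0; rewrite -/u => /eqP; apply.
  by apply/evP => v; rewrite shp z0 mul0r ev0.
move=> /shape[p [p1 p2] [z0 sh]] /shape[p' [p1' p2'] [z0' sh']].
apply/eqP; apply: contraT => ij; have := eb_ortho eb i j; rewrite (negbTE ij) /= => ip0.
have : ip (phi i) (phi j) = ev (phi i) None * (ev (phi j) None)^* * (\sum_v g p v * g p' v).
  rewrite ip_ev mulr_sumr; apply: eq_bigr => v _; rewrite sh sh' rmorphM /=.
  have -> : (g p' v)^* = g p' v; last by ring.
  by apply/CrealP; rewrite /g; case: v => [[?|?]|]; rewrite ?ger0_real ?real1.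
rewrite ip0 => /esym/eqP; rewrite !mulf_eq0 conjC_eq0 (negbTE z0) (negbTE z0') /=.
rewrite (gt_eqF _) // (bigD1 None) //= mulr1; apply: ltr_pwDl => //.
apply: sumr_ge0 => v _; apply: mulr_ge0; rewrite /g; by case: v => [[?|?]|].
Qed.

End CyclesAndEdges.

(** * Graphs of maximum degree two *)

Local Open Scope nat_scope.

Section Components.
Variables (W : finType) (e : rel W) (x0 : W).
Hypotheses (esym : symmetric e) (eirr : irreflexive e).

(** All neighbours in [W] of the listed vertices are prescribed, so the list is an entire component
    and not merely a path in the graph; likewise for [cyc_comp]. *)
Definition path_comp (p : seq W) : Prop :=
  [/\ 2 <= size p, uniq p & forall i y, i < size p ->
   e (nth x0 p i) y = (i.+1 < size p) && (y == nth x0 p i.+1)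
                      || (0 < i) && (y == nth x0 p i.-1)].

Definition cyc_comp (c : seq W) : Prop :=
  [/\ 3 <= size c, uniq c & forall i y, i < size c ->
   e (nth x0 c i) y = (y == nth x0 c (i.+1 %% size c))
                      || (y == nth x0 c ((i + (size c).-1) %% size c))].

Lemma deg_le1_adj x a : degree e x <= 1 -> e x a -> forall y, e x y = (y == a).
Proof.
move=> d1 ea y; apply/idP/eqP => [ey|->//].
apply/eqP; apply: contraTT d1 => ya; rewrite -ltnNge.
rewrite /degree; have /subset_leq_card : [set y; a] \subset [pred z | e x z].
  by apply/subsetP => z; rewrite !inE => /orP[]/eqP->.
by rewrite cards2 ya.
Qed.

Lemma deg_le2_adj x a b : degree e x <= 2 -> e x a -> e x b -> a != b ->
  forall y, e x y = (y == a) || (y == b).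
Proof.
move=> d2 ea eb ab y; apply/idP/orP => [ey|[]/eqP->//].
apply/orP; apply: contraTT d2; rewrite negb_or => /andP[ya yb]; rewrite -ltnNge.
rewrite /degree; have /subset_leq_card : y |: [set a; b] \subset [pred z | e x z].
  by apply/subsetP => z; rewrite !inE => /or3P[]/eqP->.
by rewrite cardsU1 !inE negb_or ya yb cards2 ab.
Qed.

(** The path is extended at its last vertex only, and at most [#|W|] times; the start [x] is kept so
    that it can be chosen as an end. *)
Lemma maximal_path x : exists2 p, path e x p && uniq (x :: p) &
  forall y, e (last x p) y -> y \in x :: p.
Proof.
suff H n : forall p, path e x p -> uniq (x :: p) -> #|W| <= size p + n ->
    exists2 p, path e x p && uniq (x :: p) & forall y, e (last x p) y -> y \in x :: p.
  by apply: (H #|W| [::]).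
elim: n => [|n IH] p pp up sz.
  have := leq_trans (max_card [in x :: p]) sz.
  by rewrite (card_uniqP up) /= addn0 ltnn.
have [/existsP[y /andP[ey yp]]|/existsPn no] :=
    boolP [exists y, e (last x p) y && (y \notin x :: p)].
  apply: (IH (rcons p y)); first by rewrite rcons_path pp.
    by rewrite -rcons_cons rcons_uniq yp.
  by rewrite size_rcons; lia.
by exists p; rewrite ?pp // => y ey; have := no y; rewrite ey /= negbK.
Qed.

Variable A : {set W}.
Hypothesis Aclosed : forall x y, x \in A -> e x y -> y \in A.
Hypothesis Adeg : forall x, x \in A -> 1 <= degree e x <= 2.

Local Ltac nlia := simpl in *; lia.

Section MaxPath.
Variables (x : W) (p : seq W).
Hypotheses (xA : x \in A) (pp : path e x p) (up : uniq (x :: p)).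
Hypothesis pmax : forall y, e (last x p) y -> y \in x :: p.

Local Notation c := (x :: p).
Local Notation n := (size c).
Local Notation "c`[ i ]" := (nth x0 (x :: p) i) (at level 2).

Lemma mp_adj i : i.+1 < n -> e c`[i] c`[i.+1].
Proof. by move=> h; have /(pathP x0) := pp; apply. Qed.

Lemma mp_eq i j : i < n -> j < n -> (c`[i] == c`[j]) = (i == j).
Proof. by move=> h1 h2; rewrite nth_uniq. Qed.

Lemma mp_sub y : y \in c -> y \in A.
Proof.
suff H i : i < n -> c`[i] \in A by move/(nthP x0) => [i hi <-]; apply: H.
elim: i => [//|i IH] h; apply: (Aclosed (x := c`[i])); first by apply: IH; lia.
exact: mp_adj.
Qed.

Lemma mp_deg i : i < n -> 1 <= degree e c`[i] <= 2.
Proof. by move=> h; apply: Adeg; apply: mp_sub; apply: mem_nth. Qed.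

Lemma mp_interior i : 0 < i -> i.+1 < n -> forall y,
  e c`[i] y = (y == c`[i.+1]) || (y == c`[i.-1]).
Proof.
move=> i0 i1; apply: deg_le2_adj.
- by have /andP[] := mp_deg (ltnW i1).
- exact: mp_adj.
- by rewrite esym -{2}(prednK i0); apply: mp_adj; lia.
- by rewrite mp_eq; lia.
Qed.

Lemma mp_size : 2 <= n.
Proof.
have /andP[/card_gt0P[y ey] _] := Adeg xA; rewrite inE in ey.
case: p pmax => [|//] /(_ y) /= /(_ ey); rewrite inE => /eqP yx.
by rewrite yx eirr in ey.
Qed.

(** An interior vertex already has both its neighbours next to it on the path, so the last vertex
    can only meet the first one or the one before it. *)
Lemma mp_last y : e c`[n.-1] y -> y = c`[0] \/ y = c`[n.-2].
Proof.
have n2 := mp_size; move=> ey.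
have /(nthP x0)[i hi iy] : y \in c.
  by apply: pmax; move: ey; rewrite (last_nth x0).
have [i0|i0] := posnP i; first by left; rewrite -iy i0.
right; rewrite -iy; congr (nth _ _ _).
have i1 : i != n.-1 by apply: contraTneq ey => E; rewrite -iy E eirr.
have [i2|i2] := ltnP i n.-2; last by move: hi i1 i2 n2 => /=; clear; lia.
have i3 : i.+1 < n by move: i2 => /=; clear; lia.
have := mp_interior i0 i3 c`[n.-1]; rewrite iy esym ey !mp_eq; move: i2 i0 => /=; clear; lia.
Qed.

(** A start of degree 1 has its only neighbour next on the path, so the last vertex cannot close up
    to it. *)
Lemma mp_path : degree e x <= 1 -> path_comp c.
Proof.
have n2 := mp_size; move=> dx; split=> // i y hi.
have ex0 : forall y, e c`[0] y = (y == c`[1]).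
  by apply: deg_le1_adj => //; apply: mp_adj.
have [i0|i0] := posnP i; first by rewrite i0 ex0 n2 orbF.
have [i1|i1] := ltnP i.+1 n; first by rewrite mp_interior.
have -> : i = n.-1 by lia.
apply/idP/andP => [ey|[_ /eqP->]]; last first.
  rewrite esym; have {2}-> : n.-1 = n.-2.+1 by lia.
  by apply: mp_adj; lia.
split; first by lia.
case: (mp_last ey) => [y0|->//]; move: ey; rewrite y0 esym ex0 mp_eq; try lia.
by move=> /eqP E; rewrite mp_eq; lia.
Qed.

(** The last vertex has two neighbours and, by [mp_last], only two candidates; hence it is joined to
    the first one and the path closes up. *)
Lemma mp_cyc : (forall x, x \in A -> degree e x = 2) -> cyc_comp c.
Proof.
have n2 := mp_size; move=> d2.
have dl : degree e c`[n.-1] = 2 by apply: d2; apply: mp_sub; apply: mem_nth; nlia.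
have n3 : 3 <= n /\ e c`[n.-1] c`[0].
  have sub : [pred z | e c`[n.-1] z] \subset [set c`[0]; c`[n.-2]].
    by apply/subsetP => z; rewrite !inE => /mp_last[]->; rewrite eqxx ?orbT.
  have n3 : 3 <= n.
    have := subset_leq_card sub; rewrite -/(degree _ _) dl cards2 mp_eq; nlia.
  split=> //; have : degree e c`[n.-1] == #|[set c`[0]; c`[n.-2]]|.
    by rewrite dl cards2 mp_eq; nlia.
  by move/eqP => dc; have /(subset_cardP dc)/(_ c`[0]) := sub; rewrite !inE eqxx.
case: n3 => n3 el0; split=> // i y hi.
have [i0|i0] := posnP i.
  rewrite i0 add0n !modn_small; try nlia.
  apply: deg_le2_adj; rewrite ?d2 //; [exact: mp_adj|by rewrite esym|by rewrite mp_eq; nlia].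
have -> : (i + n.-1) %% n = i.-1.
  have -> : i + n.-1 = i.-1 + n by nlia.
  by rewrite modnDr modn_small //; nlia.
have [i1|i1] := ltnP i.+1 n; first by rewrite modn_small // mp_interior.
have E : i.+1 = n by nlia.
rewrite E modnn; have -> : i = n.-1 by nlia.
apply: deg_le2_adj => //; [by rewrite dl| |by rewrite mp_eq; nlia].
by rewrite esym; have {2}-> : n.-1 = n.-2.+1; [nlia|apply: mp_adj; nlia].
Qed.

End MaxPath.

End Components.

(** Components are peeled off one at a time, by induction on the size of the closed set [A]. *)
Lemma component_decomposition (W : finType) (e : rel W) (x0 : W) :
  symmetric e -> irreflexive e -> forall A : {set W},
  (forall x y, x \in A -> e x y -> y \in A) ->
  (forall x, x \in A -> 1 <= degree e x <= 2) ->
  exists cs ps : seq (seq W), [/\ forall c, c \in cs -> cyc_comp e x0 c,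
    forall p, p \in ps -> path_comp e x0 p,
    uniq (flatten cs ++ flatten ps) & flatten cs ++ flatten ps =i A].
Proof.
move=> es ei A; have [n] := ubnP #|A|; elim: n A => // n IH A cA Acl Adeg.
have step x : x \in A -> exists2 l : seq W, x \in l /\ {subset l <= A} &
    (degree e x <= 1 -> path_comp e x0 l) /\
    ((forall x, x \in A -> degree e x = 2) -> cyc_comp e x0 l).
  move=> xA; have [p /andP[pp up] pmax] := maximal_path e x.
  exists (x :: p); first by split; [rewrite mem_head|move=> y; exact: (@mp_sub _ e x0 A Acl x p xA pp)].
  by split=> h; [exact: (@mp_path _ e x0 es ei A Acl Adeg x p xA pp up pmax h)|
    exact: (@mp_cyc _ e x0 es ei A Acl Adeg x p xA pp up pmax h)].
have rest (l : seq W) x : x \in A -> x \in l -> {subset l <= A} -> uniq l ->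
    (forall y z, y \in l -> e y z -> z \in l) ->
    exists cs ps, [/\ forall c, c \in cs -> cyc_comp e x0 c,
    forall p, p \in ps -> path_comp e x0 p,
    uniq (flatten cs ++ flatten ps) & flatten cs ++ flatten ps =i A :\: [set y in l]].
  move=> xA xl lA ul lcl; apply: IH.
  - apply: leq_trans (_ : #|A| <= n); last by [].
    apply: proper_card; apply/properP; split; first exact: subsetDl.
    by exists x; rewrite // !inE xl.
  - move=> y z; rewrite !inE => /andP[yl yA] eyz; rewrite (Acl y z) // andbT.
    by apply: contra yl => zl; apply: lcl zl _; rewrite es.
  - by move=> y; rewrite !inE => /andP[_ /Adeg].
(* Paths are removed first, each explored from one of its ends; once no vertex of degree 1 is left,
   every degree is 2 and the components are cycles. *)
have [/exists_inP[x xA dx]|/exists_inPn no1] := boolP [exists x in A, degree e x <= 1].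
  have [l [xl lA] [/(_ dx) lp _]] := step x xA; have [s2 ul adj] := lp.
  have lcl y z : y \in l -> e y z -> z \in l.
    move=> /(nthP x0)[i hi <-]; rewrite adj // => /orP[]/andP[h /eqP->]; apply: mem_nth => //.
    exact: leq_ltn_trans (leq_pred i) hi.
  have [cs [ps [Hc Hp un mem]]] := rest l x xA xl lA ul lcl.
  have pq : perm_eq (flatten cs ++ flatten (l :: ps)) (l ++ (flatten cs ++ flatten ps)).
    by rewrite /= perm_catCA.
  exists cs, (l :: ps); split=> //.
  - by move=> p; rewrite inE => /orP[/eqP->|/Hp].
  - rewrite (perm_uniq pq) cat_uniq ul un andbT.
    by apply/hasPn => y; rewrite mem !inE => /andP[].
  - move=> y; rewrite (perm_mem pq) mem_cat mem !inE.
    by case yl: (y \in l) => //=; rewrite (lA _ yl).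
have [A0|[x xA]] := set_0Vmem A.
  by exists [::], [::]; split=> // y; rewrite A0 !inE.
have d2 y : y \in A -> degree e y = 2.
  by move=> yA; have := no1 y yA; have := Adeg y yA; lia.
have [l [xl lA] [_ /(_ d2) lp]] := step x xA; have [s2 ul adj] := lp.
have lcl y z : y \in l -> e y z -> z \in l.
  move=> /(nthP x0)[i hi <-]; rewrite adj // => /orP[]/eqP->;
  by apply: mem_nth; apply: ltn_pmod; apply: leq_trans s2.
have [cs [ps [Hc Hp un mem]]] := rest l x xA xl lA ul lcl.
exists (l :: cs), ps; rewrite /= -catA; split=> //.
- by move=> p; rewrite inE => /orP[/eqP->|/Hc].
- rewrite cat_uniq ul un andbT.
  by apply/hasPn => y; rewrite mem !inE => /andP[].
- move=> y; rewrite mem_cat mem !inE.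
  by case yl: (y \in l) => //=; rewrite (lA _ yl).
Qed.

Lemma surj_card_bij (T U : finType) (g : T -> U) :
  (forall y, exists x, g x = y) -> #|T| = #|U| -> bijective g.
Proof.
move=> surj cTU.
have surj' y : exists x, g x == y by have [x <-] := surj y; exists x.
pose h y := xchoose (surj' y).
have gh : cancel h g by move=> y; apply/eqP/(xchooseP (surj' y)).
have [h' hh' h'h] : bijective h by apply: inj_card_bij (can_inj gh) _; rewrite cTU.
by exists h => // x; rewrite -{2}(h'h x) -[in RHS](gh (h' x)) h'h.
Qed.

(** Deleting the edges at [h] lowers the other degrees to 1 or 2, so the complement of [h]
    decomposes into paths and cycles. *)
Lemma hub_graph_iso (W : finType) (f : rel W) (h : W) : simple_graph f ->
  (forall v, f h v = (v != h)) -> (forall v, v != h -> 2 <= degree f v <= 3) ->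
  exists t r (s : 'I_t -> nat) (k : 'I_r -> nat),
    [/\ forall i, 3 <= s i, forall j, 2 <= k j & graph_iso (gw_adj s k) f].
Proof.
move=> [fs fi] fh fdeg; pose e x y := [&& x != h, y != h & f x y].
have es : symmetric e by move=> x y; rewrite /e fs andbCA.
have ei : irreflexive e by move=> x; rewrite /e fi !andbF.
have edeg v : v != h -> degree f v = (degree e v).+1.
  move=> vh; rewrite /degree (cardD1 h) inE fs fh vh add1n; congr _.+1.
  by apply: eq_card => y; rewrite !inE /e vh.
have [||cs [ps [Hc Hp un mem]]] := @component_decomposition W e h es ei [set~ h].
- by move=> x y _; rewrite !inE => /and3P[].
- by move=> x; rewrite !inE => xh; have := fdeg x xh; rewrite edeg.
pose s (i : 'I_(size cs)) := size (nth [::] cs i).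
pose k (j : 'I_(size ps)) := size (nth [::] ps j).
have Hc' i : cyc_comp e h (nth [::] cs (i : 'I_(size cs))) by apply/Hc/mem_nth.
have Hp' i : path_comp e h (nth [::] ps (i : 'I_(size ps))) by apply/Hp/mem_nth.
have s3 i : 3 <= s i by case: (Hc' i).
have k2 j : 2 <= k j by case: (Hp' j).
exists (size cs), (size ps), s, k; split=> //.
pose g (v : gw_vert s k) : W := match v with
  | None => h
  | Some (inl x) => nth h (nth [::] cs (tag x)) (tagged x)
  | Some (inr x) => nth h (nth [::] ps (tag x)) (tagged x)
  end.
have surj y : exists v, g v = y.
  have [->|yh] := eqVneq y h; first by exists None.
  have : y \in flatten cs ++ flatten ps by rewrite mem !inE.
  rewrite mem_cat => /orP[]/flattenP[l /(nthP [::])[i hi <-] /(nthP h)[a ha <-]].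
    by exists (Some (inl (existT (fun i => 'I_(s i)) (Ordinal hi) (Ordinal ha)))).
  by exists (Some (inr (existT (fun i => 'I_(k i)) (Ordinal hi) (Ordinal ha)))).
have szf (ll : seq (seq W)) : size (flatten ll) = \sum_(i < size ll) size (nth [::] ll i).
  rewrite size_flatten /shape sumnE big_map (big_nth [::]) big_mkord //.
have cTU : #|gw_vert s k| = #|W|.
  rewrite card_gw //; have := cardsC1 h; rewrite -(eq_card mem) (card_uniqP un) size_cat !szf.
  have : 0 < #|W| by apply/card_gt0P; exists h.
  by move=> W0 E; rewrite -[RHS](prednK W0) -E -addnA.
have gbij := surj_card_bij surj cTU; exists g; split=> //.
have ginj := bij_inj gbij.
have gh v : (g v == h) = (v == None) by rewrite -[h]/(g None) (inj_eq ginj).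
have gc i m : g (cyn k s3 i m) = nth h (nth [::] cs i) (m %% s i) by [].
have gp j m : m < k j -> g (pan s k2 j m) = nth h (nth [::] ps j) m.
  by move=> mk; rewrite /g /= modn_small.
apply: (@gw_case _ _ s k s3 k2 (fun v => forall y, gw_adj s k v y = f (g v) (g y))) =>
  [|i m|j m mk] y.
- by rewrite fh gh; case: y.
- rewrite (cyn_nbrP s3) !inE.
  have [->|yN] := eqVneq y None; first by rewrite fs fh gh.
  have -> : f (g (cyn k s3 i m.+1)) (g y) = e (g (cyn k s3 i m.+1)) (g y).
    by rewrite /e !gh yN.
  have [_ _ adj] := Hc' i; have si : 0 < s i by apply: leq_trans (s3 i).
  rewrite gc adj ?ltn_pmod // -/(s i).
  have -> : (m.+1 %% s i).+1 %% s i = m.+2 %% s i by rewrite -addn1 modnDml addn1.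
  have -> : (m.+1 %% s i + (s i).-1) %% s i = m %% s i.
    by rewrite modnDml -[m.+1]addn1 -addnA add1n prednK // modnDr.
  by rewrite -!gc !(inj_eq ginj) /= orbC.
rewrite (pan_nbrP k2 _ mk) inE.
have [->|yN] := eqVneq y None; first by rewrite fs fh gh.
have -> : f (g (pan s k2 j m)) (g y) = e (g (pan s k2 j m)) (g y).
  by rewrite /e !gh yN.
have [_ _ adj] := Hp' j; rewrite gp // adj // -/(k j) /= mem_cat orbC.
congr (_ || _).
  by case: ifP => //= m1; rewrite ?in_nil // inE -gp // (inj_eq ginj).
case: ifP => //= m0; rewrite ?in_nil // inE -gp ?(inj_eq ginj) //.
exact: leq_ltn_trans (leq_pred m) mk.
Qed.

(** * Isomorphisms between joins *)

Lemma graph_iso_trans (V W X : finType) (e : rel V) (f : rel W) (d : rel X) :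
  graph_iso e f -> graph_iso f d -> graph_iso e d.
Proof.
move=> [g [bg Hg]] [h [bh Hh]]; exists (h \o g); split; first exact: bij_comp.
by move=> x y; rewrite Hg Hh.
Qed.

Lemma wheel_gw_iso t (s : 'I_t -> nat) q :
  graph_iso (wheel_adj s q) (gw_adj s (fun _ : 'I_q => 2)).
Proof.
pose b2o (b : bool) : 'I_2 := if b then ord_max else ord0.
pose o2b (o : 'I_2) : bool := o != ord0.
have b2oK : cancel b2o o2b by case.
have o2bK : cancel o2b b2o.
  by move=> o; rewrite /o2b; case: o => [[|[|//]] ho]; apply: val_inj.
pose g (v : wheel_vert s q) : gw_vert s (fun _ : 'I_q => 2) :=
  match v with
  | None => None | Some (inl x) => Some (inl x)
  | Some (inr p) => Some (inr (Tagged (fun j : 'I_q => 'I_2) (i := p.1) (b2o p.2)))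
  end.
pose h (v : gw_vert s (fun _ : 'I_q => 2)) : wheel_vert s q :=
  match v with
  | None => None | Some (inl x) => Some (inl x)
  | Some (inr p) => Some (inr (tag p, o2b (tagged p)))
  end.
exists g; split.
  exists h; first by move=> [[x|[j b]]|] //=; rewrite b2oK.
  by move=> [[x|[j b]]|] //=; rewrite o2bK.
by move=> [[x|[j b]]|] [[y|[j' b']]|] //=; rewrite /path_adj /=; case: (j == j'); case: b b' => [] [].
Qed.

Lemma gw_perm_iso t t' r (s : 'I_t -> nat) (s' : 'I_t' -> nat) (k : 'I_r -> nat) :
  perm_eq [seq s i | i <- enum 'I_t] [seq s' i | i <- enum 'I_t'] ->
  graph_iso (gw_adj s k) (gw_adj s' k).
Proof.
move=> P; have tt' : t = t'.
  by have := perm_size P; rewrite (size_map s) (size_map s') -!cardE !card_ord.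
subst t'; have [p pE] : exists p : {perm 'I_t}, forall i, s i = s' (p i).
  have /tuple_permP[p pE] : perm_eq (mktuple s) (mktuple s') by [].
  exists p => i; have := congr1 (fun l => nth 0 l i) pE.
  by rewrite -!tnth_nth !tnth_mktuple.
have s'E i : s' i = s ((p^-1)%g i) by rewrite pE permKV.
pose g (v : gw_vert s k) : gw_vert s' k := match v with
  | Some (inl x) => Some (inl (Tagged (fun i => 'I_(s' i)) (cast_ord (pE (tag x)) (tagged x))))
  | Some (inr x) => Some (inr x) | None => None end.
pose h (v : gw_vert s' k) : gw_vert s k := match v with
  | Some (inl x) => Some (inl (Tagged (fun i => 'I_(s i)) (cast_ord (s'E (tag x)) (tagged x))))
  | Some (inr x) => Some (inr x) | None => None end.
have tagE m (r' : 'I_m -> nat) (x y : {i : 'I_m & 'I_(r' i)}) :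
    tag x = tag y -> (tagged x : nat) = tagged y -> x = y.
  case: x y => [i a] [j b] /= ij; subst j => ab; congr existT; exact: val_inj.
exists g; split.
  exists h.
    by move=> [[x|x]|] //=; congr (Some (inl _)); apply: tagE; rewrite //= permK.
  by move=> [[x|x]|] //=; congr (Some (inl _)); apply: tagE; rewrite //= permKV.
move=> [[[i a]|x]|] [[[j b]|y]|] //=; rewrite /cyc_adj /= (inj_eq perm_inj).
by rewrite -pE.
Qed.

(** * Paths *)

Local Open Scope ring_scope.

(* If no eigenvector below [L] met [v0], then [p - eps S delta_v0] would be
   orthogonal to all of them, yet its Rayleigh quotient is below [L]. *)
Lemma hub_interlace (V : finType) (e : rel V) lam phi (v0 : V) (p : fvec V) (L S : algC) :
  symmetric e -> irreflexive e -> eigenbasis e lam phi -> ev p v0 = 0 -> 0 <= L ->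
  Qop e p = L *: p + S *: delta_vec v0 -> S != 0 ->
  exists2 i, lam i < L & ev (phi i) v0 != 0.
Proof.
move=> es ei eb p0 L0 Qp S0; have [/existsP[i /andP[]]|/existsPn no] :=
  boolP [exists i, (lam i < L) && (ev (phi i) v0 != 0)]; first by exists i.
have Lr : L \is Num.real by apply: ger0_real.
have zphi i : lam i < L -> ev (phi i) v0 = 0.
  by move=> li; have := no i; rewrite li /= negbK => /eqP.
have ortho i : lam i < L -> ip p (phi i) = 0.
  move=> li; have := ip_Qop_sym es p (phi i).
  rewrite Qp (eb_eig eb) ipDl ipZl ipZl ipZr (CrealP (eb_real eb i)).
  have -> : ip (delta_vec v0) (phi i) = 0.
    by rewrite ipC ip_delta -[phi i v0]/(ev (phi i) v0) zphi // rmorph0.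
  rewrite mulr0 addr0 => /eqP; rewrite -subr_eq0 -mulrBl mulf_eq0 subr_eq0.
  by rewrite (gt_eqF li) => /eqP.
have dp : ip (delta_vec v0) p = 0 by rewrite ipC ip_delta -[p v0]/(ev p v0) p0 rmorph0.
have pd : ip p (delta_vec v0) = 0 by rewrite ip_delta.
set d := degree e v0.
have dd : ip (delta_vec v0) (delta_vec v0) = 1 by rewrite ip_delta ffunE eqxx.
have Qdd : ip (Qop e (delta_vec v0)) (delta_vec v0) = d%:R.
  by rewrite ip_delta Qop_delta // eqxx ei mul1r addr0.
have Qdp : ip (Qop e (delta_vec v0)) p = S^*.
  by rewrite ip_Qop_sym // Qp ipDr !ipZr dp dd mulr0 add0r mulr1.
(* With E = 1/(d+1), the form minus [L] times the norm is [-E |S|^2 (2 + L E - E d)], negative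
   because E d < 1 and [L >= 0]. *)
pose z := - (d.+1%:R^-1 * S).
have : L * ip (p + z *: delta_vec v0) (p + z *: delta_vec v0) <=
     ip (Qop e (p + z *: delta_vec v0)) (p + z *: delta_vec v0).
  apply: (form_lower eb) => i; rewrite real_leNgt ?(eb_real eb) //.
  apply: contra => li; rewrite ipDl ipZl ortho // ipC ip_delta.
  by rewrite -[phi i v0]/(ev (phi i) v0) zphi // rmorph0 mulr0 addr0.
rewrite linearD linearZ /= Qp !(ipDl, ipZl, ipDr, ipZr) dp pd dd Qdd Qdp !mulr0 !mulr1 !addr0 !add0r.
set E := d.+1%:R^-1 : algC.
have Er : E^* = E by apply/CrealP; rewrite realV realn.
have E0 : 0 < E by rewrite invr_gt0 ltr0n.
have zc : z^* = - (E * S^*) by rewrite /z rmorphN rmorphM /= Er.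
rewrite zc /z -/E -subr_ge0; set X := (X in 0 <= X).
have -> : X = - (E * (S * S^*) * (2 + L * E - E * d%:R)) by rewrite /X; ring.
rewrite oppr_ge0 => H; exfalso; move: H; apply/negP; rewrite lt_geF //.
apply: mulr_gt0; first by rewrite mulr_gt0 // mul_conjC_gt0.
have -> : 2 + L * E - E * d%:R = L * E + E + 1.
  have : E * d.+1%:R = 1 by rewrite mulVf // pnatr_eq0.
  rewrite -natr1 => ED; have -> : 2 = 1 + E * (d%:R + 1) by rewrite ED.
  ring.
by rewrite ltr_wpDl // addr_ge0 ?mulr_ge0 // ltW.
Qed.

Section Paths.
Variables (t r : nat) (s : 'I_t -> nat) (k : 'I_r -> nat).
Hypotheses (s3 : forall i, (3 <= s i)%N) (k2 : forall j, (2 <= k j)%N).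

Local Notation V := (gw_vert s k).
Local Notation e := (gw_adj s k).
Local Notation cyn := (cyn k s3).
Local Notation pan := (pan s k2).

Section OnePath.
Variables (j0 : 'I_r) (w y : algC).
Hypotheses (w1 : w != 1) (wk : w ^+ k j0 = -1) (yE : y = 2 + w + w^-1).

Let w0 : w != 0.
Proof.
apply: contra_eq_neq wk => ->; rewrite expr0n gtn_eqF ?(k_gt0 k2) //.
by rewrite eq_sym oppr_eq0 oner_eq0.
Qed.

(** This is [w^(m+1/2) - w^-(m+1/2)] times [w^(1/2)], which avoids a square root. The first-vertex
    equation holds for every [w], the last one by [w ^+ k j0 = -1]. *)
Let p (m : nat) : algC := w ^+ m.+1 - w ^- m.

Let p_rec m : p m + p m.+2 = (w + w^-1) * p m.+1.
Proof. by rewrite /p !exprS; field; rewrite ?expf_neq0 ?w0. Qed.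

Let p_first : p 0%N + p 1%N = y * p 0%N.
Proof. by rewrite /p yE !exprS expr0; field. Qed.

Let p_last n : n.+1 = k j0 -> p n + p n.+1 = 0.
Proof.
move=> nk; rewrite /p; have wn : w ^+ n.+1 = -1 by rewrite nk.
have wn' : w ^+ n = - w^-1 by apply: (mulfI w0); rewrite -exprS wn mulrN mulfV.
by rewrite [w ^+ n.+2]exprS wn wn' !invrN invrK invr1; field.
Qed.

Let pf (v : V) : algC := if v is Some (inr x) then
  if tag x == j0 then p (tagged x) else 0 else 0.
Let pvec : fvec V := [ffun v => pf v].
Let psum := \sum_(m < k j0) p m.

(** The geometric sums give [-4 w / (w - 1)]. With [w ^+ k j0 = 1] they would vanish, which is why
    -1 is required. *)
Let psum_neq0 : psum != 0.
Proof.
have geo x n : x != 1 -> \sum_(a < n) x ^+ a = (x ^+ n - 1) / (x - 1) :> algC.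
  by move=> x1; rewrite subrX1 mulrC mulKf // subr_eq0.
rewrite /psum /p sumrB; under eq_bigr => m _ do rewrite exprS.
under [X in _ - X]eq_bigr => m _ do rewrite -exprVn.
rewrite -mulr_sumr !geo ?invr_eq1 // exprVn wk invrN1.
have w10 : w - 1 != 0 by rewrite subr_eq0.
have -> : w * ((-1 - 1) / (w - 1)) - (-1 - 1) / (w^-1 - 1) = (-4) * w / (w - 1).
  by field; rewrite w0 w10 mulN1r subr_eq0 eq_sym.
by rewrite !mulf_neq0 ?invr_eq0 // oppr_eq0 pnatr_eq0.
Qed.

Let pvec_c i m : ev pvec (cyn i m) = 0. Proof. by rewrite /ev ffunE. Qed.
Let pvec_N : ev pvec None = 0. Proof. by rewrite /ev ffunE. Qed.
Let pvec_p j m : (m < k j)%N -> ev pvec (pan j m) = if j == j0 then p m else 0.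
Proof. by move=> mk; rewrite /ev ffunE /= modn_small. Qed.

(** Extended by zero, the path eigenvector satisfies every equation except the one at the hub, where
    the defect is the sum of its entries. *)
Lemma path_eigenvector : exists (p : fvec V) (S : algC),
  [/\ ev p None = 0, Qop e p = (1 + y) *: p + S *: delta_vec None & S != 0].
Proof.
exists pvec, psum; split=> //; apply/evP.
have dl (x v : V) : ev (delta_vec v) x = (x == v)%:R by rewrite /ev ffunE.
apply: (@gw_case _ _ s k s3 k2) => [|i m|j m mk]; rewrite evD !evZ.
- rewrite Qop_hub pvec_N !mulr0 dl eqxx mulr1 !add0r.
  rewrite big1 ?add0r => [|i _]; last by rewrite big1.
  rewrite (bigD1 j0) //= [X in _ + X]big1 ?addr0 => [|j /negbTE jj].
    by apply: eq_bigr => m _; rewrite pvec_p // eqxx.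
  by rewrite big1 // => m _; rewrite pvec_p // jj.
- by rewrite Qop_cyn !pvec_c pvec_N dl !mulr0 !addr0.
rewrite Qop_pan // pvec_N (pvec_p mk) dl mulr0 !addr0.
have -> : ev pvec (pan j m.-1) = if j == j0 then p m.-1 else 0.
  by rewrite pvec_p //; exact: leq_ltn_trans (leq_pred m) mk.
case: (eqVneq j j0) mk => [->|jj] mk; last first.
  by rewrite !addr0 mulr0 if_same add0r; case: ifP => h; rewrite ?pvec_p ?(negbTE jj) ?addr0.
rewrite mulrDl mul1r -addrA; congr (_ + _).
case: m mk => [|m] mk /=.
  by rewrite (k2 j0) pvec_p ?eqxx ?(k2 j0) // add0r p_first.
have rec : y * p m.+1 = p m.+1 + p m + (p m.+1 + p m.+2).
  have -> : p m.+1 + p m + (p m.+1 + p m.+2) = 2 * p m.+1 + (p m + p m.+2) by ring.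
  by rewrite p_rec yE; ring.
case: ltnP => h; first by rewrite pvec_p // eqxx rec.
by rewrite rec p_last //; apply/eqP; rewrite eqn_leq mk.
Qed.

End OnePath.

Lemma path_interlace lam phi j0 (w y : algC) : eigenbasis e lam phi ->
  w != 1 -> w ^+ k j0 = -1 -> y = 2 + w + w^-1 ->
  exists2 i, lam i < 1 + y & ev (phi i) None != 0.
Proof.
move=> eb w1 wk yE; have [p [S [p0 Qp S0]]] := path_eigenvector w1 wk yE.
have [es ei] := gw_simple k s3.
apply: (hub_interlace es ei eb p0 _ Qp S0); rewrite addr_ge0 //.
have wk2 : w ^+ (k j0 * 2) = 1 by rewrite exprM wk sqrrN expr1n.
have k0 : (0 < k j0 * 2)%N by rewrite muln_gt0 (k_gt0 k2).
by have /andP[] := root_unity_bounds k0 wk2 yE.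
Qed.

(** With hub entry 0, the equations from the first vertex onwards make [u] on the path a multiple of
    [p], and the last one multiplies it by [(w + 1)(w^k - w^-k)], which is nonzero. *)
Lemma path_zero (u : fvec V) (w y : algC) j : w != 0 -> w ^+ 2 != 1 ->
  y = 2 + w + w^-1 -> u \in Espace e (1 + y) -> ev u None = 0 ->
  w ^+ (2 * k j) != 1 -> forall m, (m < k j)%N -> ev u (pan j m) = 0.
Proof.
move=> w0 w21 yE /(Espace_gwP s3 k2)[_ Ep _] uN wk.
have {}Ep m : (m < k j)%N -> (if (0 < m)%N then ev u (pan j m) + ev u (pan j m.-1) else 0) +
    (if (m.+1 < k j)%N then ev u (pan j m) + ev u (pan j m.+1) else 0) = y * ev u (pan j m).
  by move=> mk; rewrite -(Ep j m mk) uN add0r.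
have w1 : w - 1 != 0 by rewrite subr_eq0; apply: contraNneq w21 => ->; rewrite expr1n.
have wN1 : w + 1 != 0.
  by rewrite addr_eq0; apply: contraNneq w21 => ->; rewrite sqrrN expr1n.
pose p (m : nat) : algC := w ^+ m.+1 - w ^- m.
have p_rec m : y * p m.+1 = p m.+1 + p m + (p m.+1 + p m.+2).
  by rewrite /p yE !exprS; field; rewrite ?expf_neq0 ?w0.
have p_first : y * p 0%N = p 0%N + p 1%N by rewrite /p yE !exprS expr0; field.
set H := fun m => ev u (pan j m); set H0 := H 0%N.
have kj := k2 j.
have sol m : ((m < k j)%N -> (w - 1) * H m = H0 * p m) /\
             ((m.+1 < k j)%N -> (w - 1) * H m.+1 = H0 * p m.+1).
  elim: m => [|m [IH1 IH2]]; split=> // mk.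
  - by rewrite /p expr1 expr0 invr1 mulrC.
  - have := Ep 0%N (ltnW kj); rewrite kj add0r -/(H 0%N) -/(H 1%N) => E.
    have -> : H 1%N = y * H0 - H0 by rewrite /H0 -E addrC addKr.
    have -> : p 1%N = y * p 0%N - p 0%N by rewrite p_first addrC addKr.
    rewrite /p expr1 expr0 invr1; ring.
  have mk1 := ltnW mk; have mk0 := ltnW mk1.
  have := Ep m.+1 mk1; rewrite mk /= -/(H m.+1) -/(H m) -/(H m.+2) => E.
  have -> : H m.+2 = y * H m.+1 - H m.+1 - H m - H m.+1 by rewrite -E; ring.
  have -> : p m.+2 = y * p m.+1 - p m.+1 - p m - p m.+1 by rewrite p_rec; ring.
  transitivity (y * ((w - 1) * H m.+1) - (w - 1) * H m.+1 - (w - 1) * H m - (w - 1) * H m.+1).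
    by ring.
  by rewrite (IH1 mk0) (IH2 mk1); ring.
have H00 : H0 = 0.
  case kE: (k j) kj => [|[|n]] // _.
  have nk : (n.+1 < k j)%N by rewrite kE.
  have := Ep n.+1 nk; rewrite kE ltnn addr0 /= -/(H n.+1) -/(H n) => E.
  have {}E : (w - 1) * H n.+1 + (w - 1) * H n = y * ((w - 1) * H n.+1).
    by rewrite -mulrDr E mulrCA.
  move: E; rewrite (sol n).2 // (sol n).1 ?(ltnW nk) // => E.
  have {}E : H0 * (p n.+1 + p n.+2) = 0.
    have -> : H0 * (p n.+1 + p n.+2) = H0 * (y * p n.+1) - (H0 * p n.+1 + H0 * p n).
      by rewrite p_rec; ring.
    by rewrite E mulrCA subrr.
  move/eqP: E; rewrite mulf_eq0 => /orP[/eqP//|].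
  have -> : p n.+1 + p n.+2 = (w + 1) * (w ^+ n.+2 - w ^- n.+2).
    by rewrite /p [w ^+ n.+3]exprS [w ^+ n.+2]exprS; field; rewrite expf_neq0 ?w0.
  rewrite mulf_eq0 (negbTE wN1) /= subr_eq0 => /eqP wn; case/negP: wk.
  by rewrite kE mul2n -addnn exprD {1}wn mulVf // expf_neq0.
move=> m mk; apply: (mulfI w1); rewrite mulr0 -/(H m) (sol m).1 // H00 mul0r //.
Qed.

(** The cycle equations are added up around the cycle; the three shifted sums are equal. *)
Lemma cyc_sum (u : fvec V) (y : algC) i : u \in Espace e (1 + y) ->
  (y - 4) * (\sum_(a < s i) ev u (cyn i a)) = (s i)%:R * ev u None.
Proof.
move=> /(Espace_gwP s3 k2)[Ec _ _]; set F := fun m => ev u (cyn i m).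
have per m : F (m + s i)%N = F m by rewrite /F; congr (ev u _); apply: cyn_mod; rewrite modnDr.
have shift (G : nat -> algC) : G (s i) = G 0%N -> \sum_(a < s i) G a.+1 = \sum_(a < s i) G a.
  case: (s i) => [|n] E; first by rewrite !big_ord0.
  by rewrite big_ord_recr big_ord_recl /= E addrC.
have E1 : \sum_(a < s i) F a.+1 = \sum_(a < s i) F a.
  by apply: shift; have := per 0%N; rewrite add0n.
have E2 : \sum_(a < s i) F a.+2 = \sum_(a < s i) F a.
  by rewrite (shift (fun m => F m.+1)) ?E1 //; have := per 1%N; rewrite add1n.
have : \sum_(a < s i) (F a + F a.+2 + ev u None) = \sum_(a < s i) ((y - 2) * F a.+1).
  by apply: eq_bigr => a _; apply: Ec.
have Z : \sum_(a < s i) ev u None = (s i)%:R * ev u None.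
  by rewrite sumr_const card_ord mulr_natl.
rewrite -mulr_sumr E1 !big_split /= E2 Z => E.
rewrite -/(\sum_(a < s i) F a); set X := \sum_(a < s i) F a in E *.
have -> : (y - 4) * X = (y - 2) * X - (X + X) by ring.
by rewrite -E; ring.
Qed.

Lemma cyc_sum_all (u : fvec V) (y : algC) : y != 4 -> u \in Espace e (1 + y) ->
  \sum_i \sum_(a < s i) ev u (cyn i a) = (ncyc s)%:R * (ev u None / (y - 4)).
Proof.
move=> y4 uE; rewrite /ncyc natr_sum mulr_suml; apply: eq_bigr => i _.
have y40 : y - 4 != 0 by rewrite subr_eq0.
by apply: (mulfI y40); rewrite (cyc_sum i uE); field.
Qed.

(** At eigenvalue 1 the path equations make the entries in positions 2i and 2i+1 add up to minus the
    hub entry. *)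
Lemma path_sum_even (u : fvec V) j : ~~ odd (k j) -> u \in Espace e 1 ->
  2 * (\sum_(b < k j) ev u (pan j b)) = - ((k j)%:R * ev u None).
Proof.
move=> ek uE.
have /(Espace_gwP s3 k2)[_ Ep _] : u \in Espace e (1 + 0) by rewrite addr0.
have {}Ep m := Ep j m; set H := fun m => ev u (pan j m); set z := ev u None in Ep *.
have kE : k j = (2 * (k j)./2)%N by rewrite mul2n -[LHS](odd_double_half (k j)) (negbTE ek).
set n := (k j)./2 in kE.
have pair i : (i < n)%N -> H (2 * i)%N + H (2 * i).+1 = - z.
  elim: i => [|i IH] hi.
    have := Ep 0%N (k_gt0 k2 j); rewrite (k2 j) /= mul0r addr0 => /eqP.
    by rewrite addrC addr_eq0 => /eqP.
  have IHi := IH (ltnW hi); have h3 : ((2 * i).+3 < k j)%N by rewrite kE; lia.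
  have := Ep (2 * i).+1 (ltnW (ltnW h3)); rewrite (ltnW h3) /= mul0r -/(H _) -/(H _) -/(H _) => E1.
  have := Ep (2 * i).+2 (ltnW h3); rewrite h3 /= mul0r -/(H _) -/(H _) -/(H _) => E2.
  have -> : (2 * i.+1 = (2 * i).+2)%N by lia.
  have E3 : H (2 * i).+1 + H (2 * i).+2 = 0.
    rewrite -E1 [H (2 * i).+1 + H (2 * i)%N]addrC IHi; ring.
  have -> : H (2 * i).+2 + H (2 * i).+3 = - (z + (H (2 * i).+1 + H (2 * i).+2)).
    by apply/eqP; rewrite -addr_eq0 -E2; apply/eqP; rewrite /H; ring.
  by rewrite E3 addr0.
have key i : (i <= n)%N -> \sum_(b < 2 * i) H b = - (i%:R * z).
  elim: i => [|i IH] hi; first by rewrite muln0 big_ord0 mul0r oppr0.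
  have -> : (2 * i.+1 = (2 * i).+2)%N by lia.
  rewrite !big_ord_recr /= IH ?(ltnW hi) // -addrA pair // -natr1; ring.
have := key n (leqnn n); rewrite -kE => ->.
have -> : (k j)%:R = 2 * n%:R :> algC by rewrite -natrM -kE.
by ring.
Qed.

(** With the cycle and path sums inserted, the hub equation becomes
    [(3 ncyc + 2 npath - 4) z = 0]. *)
Lemma even_paths_eig1 (u : fvec V) : (forall j, ~~ odd (k j)) -> u \in Espace e 1 ->
  (3 * ncyc s + 2 * npath k != 4)%N -> ev u None = 0.
Proof.
move=> ek uE n4; have uE' : u \in Espace e (1 + 0) by rewrite addr0.
have [_ _] := (Espace_gwP s3 k2 u 0).1 uE'.
rewrite (cyc_sum_all _ uE'); last by rewrite eq_sym pnatr_eq0.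
have -> : \sum_j \sum_(b < k j) ev u (pan j b) = - ((npath k)%:R * ev u None) / 2.
  rewrite /npath natr_sum mulr_suml -sumrN mulr_suml; apply: eq_bigr => j _.
  by rewrite -(path_sum_even (ek j) uE); field.
rewrite addr0 mul1r sub0r natrD; set z := ev u None => E.
have : ((3 * ncyc s + 2 * npath k)%:R - 4) * z = 0.
  rewrite natrD !natrM; transitivity (4 * (((ncyc s)%:R + (npath k)%:R) * z +
    (ncyc s)%:R * (z / -4) + - ((npath k)%:R * z) / 2 - z)); first by field.
  by rewrite E subrr mulr0.
by move/eqP; rewrite mulf_eq0 subr_eq0 eqr_nat (negbTE n4) => /eqP.
Qed.

End Paths.

(** * Roots of unity *)

Lemma root_unity_neq0 (v : algC) n : (0 < n)%N -> v ^+ n = 1 -> v != 0.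
Proof.
by move=> n0; apply: contra_eq_neq => ->; rewrite expr0n gtn_eqF // eq_sym oner_eq0.
Qed.

Lemma cosine_bounds (v : algC) n : (0 < n)%N -> v ^+ n = 1 -> -2 <= v + v^-1 <= 2.
Proof.
move=> n0 vn; have /andP[a b] := root_unity_bounds n0 vn erefl.
apply/andP; split; rewrite -subr_ge0.
  by have -> : v + v^-1 - -2 = 2 + v + v^-1 by ring.
by have -> : 2 - (v + v^-1) = 4 - (2 + v + v^-1); [ring|rewrite subr_ge0].
Qed.

Lemma cosine_real (v : algC) n : (0 < n)%N -> v ^+ n = 1 -> v + v^-1 \is Num.real.
Proof.
by move=> n0 vn; rewrite (root_unity_inv n0 vn); apply/CrealP; rewrite rmorphD /= conjCK addrC.
Qed.

Lemma cosine_eq2 (v : algC) : v != 0 -> v + v^-1 = 2 -> v = 1.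
Proof.
move=> v0 E; apply/eqP; rewrite -subr_eq0 -sqrf_eq0; apply/eqP.
have -> : (v - 1) ^+ 2 = v * (v + v^-1 - 2) by field.
by rewrite E subrr mulr0.
Qed.

(** Take the square root [v'] with [c = v' + v'^-1] nonnegative: [v + v^-1] is [c^2 - 2], and
    [c - (c^2 - 2) = (2 - c)(c + 1)] is positive. *)
Lemma half_angle (v : algC) n : (0 < n)%N -> v ^+ n = 1 -> v != 1 ->
  exists v', [/\ v' ^+ (2 * n) = 1, v' != 1 & v + v^-1 < v' + v'^-1].
Proof.
move=> n0 vn v1.
have key v' : v' ^+ 2 = v -> 0 <= v' + v'^-1 ->
    [/\ v' ^+ (2 * n) = 1, v' != 1 & v + v^-1 < v' + v'^-1].
  move=> vv c0; have v'n : v' ^+ (2 * n) = 1 by rewrite exprM vv.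
  have n20 : (0 < 2 * n)%N by rewrite muln_gt0.
  have v'0 := root_unity_neq0 n20 v'n.
  have v'1 : v' != 1 by apply: contraNneq v1 => E; rewrite -vv E expr1n.
  split=> //; set c := v' + v'^-1 in c0 *.
  have cr : c \is Num.real by apply: ger0_real.
  have -> : v + v^-1 = c ^+ 2 - 2 by rewrite -vv /c; field.
  have /andP[_ c2] := cosine_bounds n20 v'n.
  have {}c2 : c < 2.
    by rewrite lt_neqAle c2 andbT; apply: contra v'1 => /eqP/(cosine_eq2 v'0)->.
  rewrite -subr_gt0; have -> : c - (c ^+ 2 - 2) = (2 - c) * (c + 1) by ring.
  by rewrite mulr_gt0 ?subr_gt0 // ltr_wpDl.
pose x := sqrtC v; have xx : x ^+ 2 = v by rewrite sqrtCK.
have xr : x + x^-1 \is Num.real.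
  by apply: (@cosine_real _ (2 * n)); rewrite ?muln_gt0 // exprM xx.
have [c0|c0] := real_leP (real0 _) xr; first by exists x; apply: key.
exists (- x); apply: key; first by rewrite sqrrN.
by rewrite invrN -opprD oppr_ge0 ltW.
Qed.

(* Averaging [(c - 1) (c + 2) ^ 3] with [c = x + 1/x] over the n-th roots of unity
   [x] gives 10, while [x = 1] contributes only 64. *)
Lemma large_cosine n : (7 <= n)%N ->
  exists v : algC, [/\ v ^+ n = 1, v != 1 & 1 < v + v^-1].
Proof.
move=> n7; have n0 : (0 < n)%N by lia.
have [z zP] := C_prim_root_exists n0.
have zn := prim_expr_order zP.
have [/existsP[a /andP[a1 a2]]|/existsPn no] :=
    boolP [exists a : 'I_n, (z ^+ a != 1) && (1 < z ^+ a + (z ^+ a)^-1)].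
  by exists (z ^+ a); split=> //; rewrite exprAC zn expr1n.
have geo x : x != 1 -> x ^+ n = 1 -> \sum_(a < n) x ^+ a = 0 :> algC.
  move=> x1 xn; have := subrX1 x n; rewrite xn subrr => /esym/eqP.
  by rewrite mulf_eq0 subr_eq0 (negbTE x1) => /eqP.
have S j : (0 < j < n)%N -> \sum_(a < n) (z ^+ a) ^+ j = 0.
  move=> /andP[j0 jn]; under eq_bigr => a _ do rewrite exprAC.
  apply: geo; last by rewrite exprAC zn expr1n.
  by rewrite -(expr0 z) (eq_prim_root_expr zP) mod0n modn_small // -lt0n.
have S' j : (0 < j < n)%N -> \sum_(a < n) (z ^+ a)^-1 ^+ j = 0.
  move=> /S/(congr1 Num.conj); rewrite rmorph0 rmorph_sum => E; rewrite -[RHS]E.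
  apply: eq_bigr => a _; rewrite rmorphXn /= -(@root_unity_inv (z ^+ a) n) //.
  by rewrite exprAC zn expr1n.
pose f (x : algC) : algC := (x + x^-1 - 1) * (x + x^-1 + 2) ^+ 3.
have tot : \sum_(a < n) f (z ^+ a) = 10 * n%:R.
  have sum10 : \sum_(a < n) (10 : algC) = 10 * n%:R by rewrite sumr_const card_ord mulr_natr.
  have [c cE] : exists c : algC, c = 10 by exists 10.
  rewrite -sum10 -cE.
  transitivity (\sum_(a < n) ((z ^+ a) ^+ 4 + (z ^+ a)^-1 ^+ 4
      + 5 * (z ^+ a) ^+ 3 + 5 * (z ^+ a)^-1 ^+ 3 + 10 * (z ^+ a) ^+ 2 + 10 * (z ^+ a)^-1 ^+ 2
      + 11 * (z ^+ a) ^+ 1 + 11 * (z ^+ a)^-1 ^+ 1 + c)).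
    apply: eq_bigr => a _; have x0 : z ^+ a != 0.
      by apply: (root_unity_neq0 n0); rewrite exprAC zn expr1n.
    by rewrite /f cE; move: (z ^+ a) x0 => x x0; field.
  rewrite !big_split /= -!mulr_sumr !S ?S' //; try lia.
  by rewrite !mulr0 !add0r.
have : \sum_(a < n) f (z ^+ a) <= 64.
  rewrite (bigD1 (Ordinal n0)) //= expr0 -[64]addr0; apply: lerD.
    by rewrite /f invr1 le_eqVlt; apply/orP; left; apply/eqP; ring.
  apply: sumr_le0 => a a0; have xn : (z ^+ a) ^+ n = 1 by rewrite exprAC zn expr1n.
  have := no a; rewrite negb_and negbK => /orP[/eqP E|].
    case/negP: a0; rewrite -val_eqE /=.
    by move/eqP: E; rewrite -(expr0 z) (eq_prim_root_expr zP) mod0n modn_small.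
  rewrite -real_leNgt ?real1 ?(cosine_real n0 xn) // => c1.
  have /andP[c2 _] := cosine_bounds n0 xn.
  rewrite /f mulr_le0_ge0 ?subr_le0 // exprn_ge0 //.
  by rewrite -[X in 0 <= _ + X]opprK subr_ge0.
by rewrite tot -natrM ler_nat; lia.
Qed.

(** All candidates are roots of unity of the common order [N], so there are finitely many; -1 is
    always one of them. *)
Lemma max_cosine r (k : 'I_r -> nat) (j1 : 'I_r) : (forall j, (2 <= k j)%N) ->
  exists (j : 'I_r) (v : algC), [/\ v ^+ (2 * k j) = 1, v != 1 &
    forall j' v', v' ^+ (2 * k j') = 1 -> v' != 1 -> v' + v'^-1 <= v + v^-1].
Proof.
move=> k2; pose N := (\prod_j (2 * k j))%N.
have k0 j : (0 < 2 * k j)%N by have := k2 j; lia.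
have N0 : (0 < N)%N by apply: prodn_gt0.
have [z zP] := C_prim_root_exists N0; have zN := prim_expr_order zP.
have zaN a : (z ^+ a) ^+ N = 1 by rewrite exprAC zN expr1n.
pose P (a : 'I_N) := (z ^+ a != 1) && [exists j, (z ^+ a) ^+ (2 * k j) == 1].
pose F (a : 'I_N) := z ^+ a + (z ^+ a)^-1.
have toz j v : v ^+ (2 * k j) = 1 -> exists a : 'I_N, v = z ^+ a.
  move=> vk; have vN : v ^+ N = 1 by rewrite /N (bigD1 j) //= exprM vk expr1n.
  by have [a ->] := prim_rootP zP vN; exists a.
have Pz j v (a : 'I_N) : v ^+ (2 * k j) = 1 -> v != 1 -> v = z ^+ a -> P a.
  by move=> vk v1 va; rewrite /P -va v1 /=; apply/existsP; exists j; apply/eqP.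
have m1k : (-1 : algC) ^+ (2 * k j1) = 1 by rewrite exprM sqrrN !expr1n.
have m11 : (-1 : algC) != 1 by rewrite eqNr oner_eq0.
have [a0 a0E] := toz j1 _ m1k.
have Pa0 := Pz _ _ _ m1k m11 a0E.
have Fr a : P a -> F a \is Num.real by move=> _; apply: (cosine_real N0).
have [a /andP[a1 /existsP[j /eqP aj]] amax] := real_arg_maxP Pa0 Fr.
exists j, (z ^+ a); split=> // j' v' vk v1.
have [b bE] := toz j' v' vk; have := amax b (Pz _ _ _ vk v1 bE).
by rewrite /F -bE.
Qed.

(** * Cospectral mates that are joins *)

Section PathExclusion.
Variables (t q t' r : nat) (s : 'I_t -> nat) (s' : 'I_t' -> nat) (k : 'I_r -> nat).
Hypotheses (s3 : forall i, (3 <= s i)%N) (s3' : forall i, (3 <= s' i)%N).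
Hypothesis k2 : forall j, (2 <= k j)%N.
Hypothesis n3_gt3 : (3 < ncyc s)%N.
Hypothesis nbig : (3 * ncyc s' + 2 * npath k != 4)%N.
Local Notation e0 := (gw_adj s (fun _ : 'I_q => 2%N)).
Local Notation e := (gw_adj s' k).
Hypothesis cosp : forall x, Q_eig_mult e0 x = Q_eig_mult e x.

Let cyn := @cyn t' r s' k s3'.
Let pan := @pan t' r s' k k2.

Let dimE x : \dim (Espace e x) = \dim (Espace e0 x).
Proof.
have [es _] := gw_simple k s3'; have [es0 _] := gw_simple (fun _ : 'I_q => 2%N) s3.
have [? [? eb]] := eigenbasis_exists es; have [? [? eb0]] := eigenbasis_exists es0.
by rewrite (dim_Espace eb) (dim_Espace eb0) cosp.
Qed.

(* Otherwise [u] would contribute exactly one dimension besides the resonant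
   cycles, making the multiplicity odd. *)
Lemma hub_entry_eq0 (y w : algC) (u : fvec (gw_vert s' k)) :
  y \is Num.real -> 0 < y -> y < 1 -> w != 0 -> y = 2 + w + w^-1 ->
  (forall j, w ^+ (2 * k j) != 1) -> u \in Espace e (1 + y) -> ev u None = 0.
Proof.
move=> yr y0 y1 w0 yE wk uE; apply/eqP; apply: contraT => z0.
have y4 : y != 4 by rewrite lt_eqF //; apply: lt_trans y1 _; rewrite ltr1n.
have y0' : y != 0 by rewrite gt_eqF.
have w1 := joukowski_sqr_neq1 yE y0' y4.
have y40 : y - 4 != 0 by rewrite subr_eq0.
have [K KP Kdim] := gw_dim s3' k2 w0 w1 yE.
(* Averaging [u] on the cycles keeps their total by [cyc_sum_all], hence the hub equation, and gives
   an element of [K]. *)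
pose uf (v : gw_vert s' k) : algC := if v is Some (inl _) then ev u None / (y - 4) else ev u v.
pose u' : fvec (gw_vert s' k) := [ffun v => uf v].
have u'N : ev u' None = ev u None by rewrite {1}/ev ffunE.
have u'c i m : ev u' (cyn i m) = ev u None / (y - 4) by rewrite {1}/ev ffunE.
have u'p j m : ev u' (pan j m) = ev u (pan j m) by rewrite {1}/ev ffunE.
have u'K : u' \in K.
  apply/KP; split; last by move=> i m; rewrite u'N; apply: u'c.
  have [Ec Ep Eh] := (Espace_gwP s3' k2 u y).1 uE.
  apply/(Espace_gwP s3' k2); split=> [i m|j m mk|].
  - by rewrite -/cyn !u'c u'N; field.
  - by rewrite -/pan !u'p u'N; apply: Ep.
  rewrite u'N -Eh (cyc_sum_all s3' k2 y4 uE); congr (_ + _ + _).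
    by apply: sum_cyc_const => i m; apply: u'c.
  by apply: eq_bigr => j _; apply: eq_bigr => b _; apply: u'p.
(* An element of [K] with hub entry 0 vanishes on the cycles, and on the paths by [path_zero]. *)
have KE : K = <[u']>%VS.
  apply/vspaceP => x; apply/idP/vlineP => [xK|[c ->]]; last exact: memvZ.
  exists (ev x None / ev u None); apply/eqP; rewrite -subr_eq0; apply/eqP.
  set d := x - _; have dK : d \in K by rewrite rpredB // memvZ.
  have dN : ev d None = 0 by rewrite /d evD evN evZ u'N; field.
  have [dE dc] := (KP d).1 dK.
  apply/evP; apply: (@gw_case _ _ s' k s3' k2) => [|i m|j m mk]; rewrite ev0 //.
    by rewrite dc dN mul0r.
  exact: (path_zero s3' k2 w0 w1 yE dE dN (wk j)).
have dK1 : \dim K = 1%N.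
  rewrite KE dim_vline; apply/eqP; rewrite eqb1; apply: contraNneq z0 => u0.
  by rewrite -u'N u0 ev0.
have := Kdim; rewrite dimE (fw_dim q s3 n3_gt3 yr y1 y0' w0 yE) dK1; lia.
Qed.

(** An odd path, or an even one of order at least 4, would push an eigenvalue with nonzero hub entry
    to a place where the given graph allows none. *)
Lemma all_paths_K2 j : k j = 2%N.
Proof.
have [es _] := gw_simple k s3'; have [es0 _] := gw_simple (fun _ : 'I_q => 2%N) s3.
have [lam [phi eb]] := eigenbasis_exists es.
have [lam0 [phi0 eb0]] := eigenbasis_exists es0.
have lam1 i : 1 <= lam i.
  have : (0 < #|[pred i0 | lam0 i0 == lam i]|)%N.
    by rewrite -(eb_mult eb0) cosp (eb_mult eb); apply/card_gt0P; exists i; rewrite inE.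
  by case/card_gt0P => i0; rewrite inE => /eqP <-; apply: (fw_eig_ge1 s3 n3_gt3 eb0).
have m11 : (-1 : algC) != 1 by rewrite eqNr oner_eq0.
(* On an odd path [w = -1] is admissible and gives [y = 0], hence an eigenvalue strictly below 1. *)
have ek j' : ~~ odd (k j').
  apply/negP => ok.
  have wk : (-1 : algC) ^+ k j' = -1 by rewrite -signr_odd ok expr1.
  have yE : (0 : algC) = 2 + -1 + (-1)^-1 by rewrite invrN1; ring.
  have [i] := path_interlace s3' k2 eb m11 wk yE.
  by rewrite addr0 => li; have := lam1 i; rewrite (lt_geF li).
apply/eqP; rewrite eqn_leq k2 andbT leqNgt; apply/negP => kj3.
have kj4 : (4 <= k j)%N by have := ek j; case: (k j) kj3 => [|[|[|[|]]]].
(* Via [w = -v], the largest [v + v^-1] gives the smallest nonzero [y] carried by a path, as all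
   orders are even. *)
have [j1 [v [vk v1 vmax]]] := max_cosine j k2.
have k0 j' : (0 < k j')%N := k_gt0 k2 j'.
have k20 j' : (0 < 2 * k j')%N by rewrite muln_gt0 k0.
(* If this power were 1, halving the angle would beat the maximum; so it is -1, as [path_interlace]
   requires. *)
have vk1 : v ^+ k j1 != 1.
  apply/eqP => vE; have [v' [v'k v'1 c]] := half_angle (k0 j1) vE v1.
  by have := vmax _ _ v'k v'1; rewrite (lt_geF c).
have vkN : v ^+ k j1 = -1.
  apply/eqP; have : (v ^+ k j1) ^+ 2 == 1 by rewrite -exprM mulnC vk.
  by rewrite sqrf_eq1 (negbTE vk1).
pose w := - v; have wk : w ^+ k j1 = -1.
  by rewrite /w exprNn -signr_odd (negbTE (ek j1)) expr0 mul1r.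
have w1 : w != 1.
  apply: contraNneq vk1 => wE; have -> : v = -1 by rewrite -wE /w opprK.
  by rewrite -signr_odd (negbTE (ek j1)).
pose y1 := 2 + w + w^-1.
(* The path of order at least 4 supplies roots of unity of order [2 * k j >= 8], enough for
   [large_cosine]; thus [y1 < 1]. *)
have c1 : 1 < v + v^-1.
  have [|v' [v'k v'1 c]] := @large_cosine (2 * k j); first by lia.
  by apply: lt_le_trans c _; apply: (vmax j).
have y1E : y1 = 2 - (v + v^-1) by rewrite /y1 /w invrN; ring.
have y1lt : y1 < 1.
  by rewrite y1E ltrBlDr -ltrBlDl; have -> : 2 - 1 = 1 :> algC by ring.
have [i li zi] := path_interlace s3' k2 eb w1 wk (erefl y1).
pose y := lam i - 1; have lE : lam i = 1 + y by rewrite /y; ring.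
have phiE := eigenbasis_mem eb i; rewrite lE in phiE li.
have yr : y \is Num.real by rewrite realB ?(eb_real eb) ?real1.
have y0 : 0 <= y by rewrite subr_ge0.
have yy1 : y < y1 by move: li; rewrite ltrD2l.
case/negP: zi; apply/eqP.
have [yz|ynz] := eqVneq y 0.
  apply: (even_paths_eig1 s3' k2 ek _ nbig); by rewrite yz addr0 in phiE.
have y0' : 0 < y by rewrite lt_neqAle eq_sym ynz.
have [x x0 yE] := joukowski y.
(* No path carries [y]: a root [x] with [x ^+ (2 * k j') = 1] would make [-x] a candidate beating
   [v], since [y < y1]. *)
apply: (hub_entry_eq0 yr y0' (lt_trans yy1 y1lt) x0 yE _ phiE) => j'.
apply/eqP => xk.
have Nxk : (- x) ^+ (2 * k j') = 1 by rewrite exprNn exprM sqrrN !expr1n mul1r.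
have Nx1 : - x != 1.
  apply: contraNneq ynz => xE; rewrite yE -[x]opprK xE invrN1; apply/eqP; ring.
have := vmax _ _ Nxk Nx1; apply/negP; rewrite lt_geF //.
have -> : - x + (- x)^-1 = 2 - y by rewrite yE invrN; ring.
have -> : v + v^-1 = 2 - y1 by rewrite y1E; ring.
by rewrite ltrD2l ltrN2.
Qed.

End PathExclusion.

(** * Recovering the cycle lengths *)

Section Resonance.
Variables (t t' r : nat) (s : 'I_t -> nat) (s' : 'I_t' -> nat) (k : 'I_r -> nat).
Hypotheses (s3 : forall i, (3 <= s i)%N) (s3' : forall i, (3 <= s' i)%N).
Hypothesis k2 : forall j, (2 <= k j)%N.
Hypothesis ncycE : ncyc s = ncyc s'.
Hypothesis cosp : forall x, Q_eig_mult (gw_adj s k) x = Q_eig_mult (gw_adj s' k) x.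

(** A vector constant on the cycles enters the hub equation only through the total number of cycle
    vertices, so it can be moved to other cycles with the same total. *)
Lemma transfer_K (ta tb : nat) (sa : 'I_ta -> nat) (sb : 'I_tb -> nat)
    (sa3 : forall i, (3 <= sa i)%N) (sb3 : forall i, (3 <= sb i)%N) (y : algC)
    (u : fvec (gw_vert sa k)) : ncyc sa = ncyc sb -> y != 4 ->
  u \in Espace (gw_adj sa k) (1 + y) ->
  (forall i m, ev u (cyn k sa3 i m) = ev u None / (y - 4)) ->
  let u' : fvec (gw_vert sb k) := [ffun v : gw_vert sb k => match v with
     | None => ev u None | Some (inl _) => ev u None / (y - 4)
     | Some (inr x) => ev u (Some (inr x)) end] in
  u' \in Espace (gw_adj sb k) (1 + y) /\
  (forall i m, ev u' (cyn k sb3 i m) = ev u' None / (y - 4)).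
Proof.
move=> nE y4 uE uc u'; have y40 : y - 4 != 0 by rewrite subr_eq0.
have u'N : ev u' None = ev u None by rewrite {1}/ev ffunE.
have u'c i m : ev u' (cyn k sb3 i m) = ev u None / (y - 4) by rewrite {1}/ev ffunE.
have u'p j m : ev u' (pan sb k2 j m) = ev u (pan sa k2 j m) by rewrite {1}/ev ffunE.
split; last by move=> i m; rewrite u'c u'N.
have [Ec Ep Eh] := (Espace_gwP sa3 k2 u y).1 uE.
apply/(Espace_gwP sb3 k2); split=> [i m|j m mk|].
- by rewrite !u'c u'N; field.
- by rewrite !u'p u'N; apply: Ep.
rewrite u'N -Eh (sum_cyc_const uc) (sum_cyc_const u'c) nE; congr (_ + _ + _).
by apply: eq_bigr => j _; apply: eq_bigr => b _; apply: u'p.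
Qed.

(** The spaces [K] of the two graphs correspond under this transfer, so equal multiplicities leave
    equal resonant parts in [gw_dim]. *)
Lemma resonant_card (w : algC) : w != 0 -> w ^+ 2 != 1 ->
  #|resonant s w| = #|resonant s' w|.
Proof.
move=> w0 w1; pose y := 2 + w + w^-1.
have y4 : y != 4 by rewrite -subr_eq0 (y_neq4 w0 w1).
have [es _] := gw_simple k s3'; have [es0 _] := gw_simple k s3.
have [? [? eb]] := eigenbasis_exists es; have [? [? eb0]] := eigenbasis_exists es0.
have [K KP Kd] := gw_dim s3 k2 w0 w1 (erefl y).
have [K' KP' Kd'] := gw_dim s3' k2 w0 w1 (erefl y).
have dE : \dim (Espace (gw_adj s k) (1 + y)) = \dim (Espace (gw_adj s' k) (1 + y)).
  by rewrite (dim_Espace eb) (dim_Espace eb0) cosp.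
suff dK : \dim K = \dim K' by move: dE; rewrite Kd Kd' dK; lia.
pose F (u : fvec (gw_vert s k)) : fvec (gw_vert s' k) :=
  [ffun v : gw_vert s' k => match v with
     | None => ev u None | Some (inl _) => ev u None / (y - 4)
     | Some (inr x) => ev u (Some (inr x)) end].
have FE u v : ev (F u) v = match v with
     | None => ev u None | Some (inl _) => ev u None / (y - 4)
     | Some (inr x) => ev u (Some (inr x)) end by rewrite {1}/ev ffunE.
have lF : linear F.
  move=> a u v; apply/evP => x; rewrite evD evZ !FE.
  by case: x => [[x|x]|]; rewrite !evD !evZ //; ring.
apply: (dim_bij lF).
- move=> u /KP[uE uc] Fu; have F0 v : ev (F u) v = 0 by rewrite Fu ev0.
  have uN : ev u None = 0 by rewrite -(F0 None) FE.
  apply/evP; apply: (@gw_case _ _ s k s3 k2) => [|i m|j m mk]; rewrite ev0 //.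
    by rewrite uc uN mul0r.
  by rewrite -(F0 (pan s' k2 j m)) FE.
- by move=> u /KP[uE uc]; apply/KP'; apply: transfer_K.
move=> v /KP'[vE vc].
have [uE uc] := transfer_K s3 (esym ncycE) y4 vE vc.
set u := [ffun _ => _] in uE uc; exists u; first by apply/KP.
have uEv x : ev u x = match x with
     | None => ev v None | Some (inl _) => ev v None / (y - 4)
     | Some (inr x) => ev v (Some (inr x)) end by rewrite {1}/ev ffunE.
apply/evP; apply: (@gw_case _ _ s' k s3' k2) => [|i m|j m mk]; by rewrite FE /= !uEv ?vc.
Qed.

End Resonance.

Lemma seq_nat_max (S : seq nat) : S != [::] ->
  exists2 M, M \in S & forall x, x \in S -> (x <= M)%N.
Proof.
elim: S => [//|y [|z S] IH] _; first by exists y => [|x]; rewrite inE // => /eqP->.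
have [//|M MS Mmax] := IH _; have [yM|My] := leqP y M.
  by exists M => [|x]; rewrite inE ?MS ?orbT // => /orP[/eqP->|/Mmax].
by exists y => [|x]; rewrite inE ?eqxx // => /orP[/eqP->//|/Mmax h]; apply: leq_trans h (ltnW My).
Qed.

(** The maximum [M] of [S] divides some [x] in [S'], which divides some [y] in [S]; as [y <= M],
    [x = M]. Removing [M] from both lists preserves the counts. *)
Lemma perm_eq_from_dvdn (S S' : seq nat) :
  all (leq 3) S -> all (leq 3) S' ->
  (forall m, (3 <= m)%N -> count (dvdn m) S = count (dvdn m) S') -> perm_eq S S'.
Proof.
have [n] := ubnP (size S); elim: n S S' => // n IH S S' szS aS aS' H.
case: S => [|x0 S0] in szS aS H *.
  case: S' aS' H => [//|y S'] /= /andP[y3 _] /(_ y y3) /=.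
  by rewrite dvdnn.
set S := x0 :: S0 in szS aS H *.
have [M MS Mmax] : exists2 M, M \in S & forall x, x \in S -> (x <= M)%N.
  exact: seq_nat_max.
have M3 : (3 <= M)%N by apply: (allP aS).
have [x xS' Mx] : exists2 x, x \in S' & (M %| x)%N.
  by apply/hasP; rewrite has_count -H // -has_count; apply/hasP; exists M.
have x3 : (3 <= x)%N by apply: (allP aS').
have xM : x = M.
  have [y yS xy] : exists2 y, y \in S & (x %| y)%N.
    by apply/hasP; rewrite has_count H // -has_count; apply/hasP; exists x.
  have y3 : (3 <= y)%N by apply: (allP aS).
  apply/eqP; rewrite eqn_leq (leq_trans (dvdn_leq _ xy) (Mmax _ yS)); last by lia.
  by apply: dvdn_leq Mx; lia.
rewrite xM in xS'.
have P1 := perm_to_rem MS; have P2 := perm_to_rem xS'.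
rewrite (permPl P1) perm_sym (permPl P2) perm_cons perm_sym; apply: IH.
- by rewrite size_rem //; move: szS; rewrite /S /=; lia.
- by apply/allP => z /mem_rem; apply: (allP aS).
- by apply/allP => z /mem_rem; apply: (allP aS').
by move=> m m3; have := H m m3; rewrite (seq.permP P1) (seq.permP P2) /= => /addnI.
Qed.

Lemma resonant_prim t (s : 'I_t -> nat) (z : algC) m : m.-primitive_root z ->
  #|resonant s z| = count (dvdn m) [seq s i | i <- enum 'I_t].
Proof.
move=> zP; rewrite count_map -sum1_count big_enum_cond -sum1_card.
by apply: eq_bigl => i; rewrite inE /= (prim_order_dvd zP).
Qed.

(** * From the spectrum to the isomorphism *)

Lemma degree_lt_card (W : finType) (f : rel W) v : irreflexive f ->
  (degree f v <= #|W| - 1)%N.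
Proof.
move=> fi; rewrite subn1 -(cardC1 v); apply: subset_leq_card; apply/subsetP => x.
by rewrite !inE => fx; apply: contraTneq fx => ->; rewrite fi.
Qed.

Lemma full_degree_adj (W : finType) (f : rel W) h : irreflexive f ->
  degree f h = (#|W| - 1)%N -> forall v, f h v = (v != h).
Proof.
move=> fi dh v.
have sub : [pred x | f h x] \subset predC1 h.
  by apply/subsetP => x; rewrite !inE => fx; apply: contraTneq fx => ->; rewrite fi.
have cE : #|[pred x | f h x]| = #|predC1 h| by rewrite cardC1 -subn1 -dh.
by have /(subset_cardP cE)/(_ v) := sub; rewrite !inE.
Qed.

Lemma fw_degree_sqr t q (s : 'I_t -> nat) : (forall i, (3 <= s i)%N) ->
  (\sum_v (degree (gw_adj s (fun _ : 'I_q => 2%N)) v ^ 2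
          + degree (gw_adj s (fun _ : 'I_q => 2%N)) v)
   = (ncyc s + 2 * q) ^ 2 + (ncyc s + 2 * q) + 12 * ncyc s + 12 * q)%N.
Proof.
move=> s3; have k2 (j : 'I_q) : (2 <= 2)%N by [].
rewrite (@gw_sum_nat _ _ s (fun=> 2%N) s3 k2) degree_hub // npath2.
congr (_ + _ + _)%N.
  rewrite /ncyc big_distrr /=; apply: eq_bigr => i _.
  rewrite (eq_bigr (fun=> 12%N)) ?sum_nat_const ?card_ord 1?mulnC // => a _.
  by rewrite degree_cyn_ord.
rewrite (eq_bigr (fun=> 12%N)) ?sum_nat_const ?card_ord 1?mulnC // => j _.
by rewrite !big_ord_recr big_ord0 /= !degree_pan.
Qed.

Theorem theorem1p2 (t : nat) (s : 'I_t -> nat) (q : nat) :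
  (2 <= t)%N ->
  (forall i, 3 <= s i)%N ->
  (52 <= 1 + \sum_(i < t) s i + 2 * q)%N ->
  forall (W : finType) (f : rel W),
    simple_graph f ->
    Q_cospectral (wheel_adj s q) f ->
    graph_iso (wheel_adj s q) f.
Proof.
move=> t2 s3 n52 W f fS cosp0.
have k2 (j : 'I_q) : (2 <= 2)%N by [].
have n3 : (3 < ncyc s)%N.
  have : (\sum_(i < t) 3 <= ncyc s)%N by apply: leq_sum => i _.
  by rewrite sum_nat_const card_ord; lia.
set e := gw_adj s (fun _ : 'I_q => 2%N).
have eS : simple_graph e := gw_simple (fun _ : 'I_q => 2%N) s3.
have iso0 := wheel_gw_iso s q.
have wS : simple_graph (wheel_adj s q).
  have [g [_ gE]] := iso0; have [es ei] := eS.
  by split=> [x y|x]; rewrite !gE ?es ?ei.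
have cosp x : Q_eig_mult e x = Q_eig_mult f x.
  by rewrite -(graph_iso_mult wS eS iso0) cosp0.
have [lam [phi eb]] := eigenbasis_exists eS.1.
have [mu [psi ebf]] := eigenbasis_exists fS.1.
have cnt x : #|[pred i | lam i == x]| = #|[pred j | mu j == x]|.
  by rewrite -(eb_mult eb) -(eb_mult ebf).
have mu1 j : 1 <= mu j.
  have : (0 < #|[pred i | lam i == mu j]|)%N.
    by rewrite cnt; apply/card_gt0P; exists j; rewrite inE.
  by case/card_gt0P => i; rewrite inE => /eqP <-; apply: (fw_eig_ge1 s3 n3 eb).
(* The number of eigenvalues above 5 is a spectral invariant, and it is at most 1 for the given
   graph. *)
have mu5 i j : 5 < mu i -> 5 < mu j -> i = j.
  move=> mi mj; apply/eqP; apply: contraT => ij.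
  have : (\sum_i (5 < lam i)%R <= 1)%N.
    have [/existsP[i0 li0]|/existsPn no] := boolP [exists i, 5 < lam i].
      rewrite (bigD1 i0) //= li0 big1 // => i1 i10; case l1: (5 < lam i1) => //.
      by rewrite (fw_eig_gt5 s3 eb l1 li0) eqxx in i10.
    by rewrite big1 // => i1 _; rewrite (negbTE (no i1)).
  have -> : (\sum_i (5 < lam i)%R = \sum_j (5 < mu j)%R)%N.
    exact: (cospectral_sum (fun x : algC => nat_of_bool (5 < x)) cnt).
  by rewrite (bigD1 i) //= (bigD1 j) 1?eq_sym //= mi mj.
have card_eq : #|gw_vert s (fun _ : 'I_q => 2%N)| = #|W|.
  have := cospectral_sum (fun=> 1%N) cnt; rewrite -!sum1_card; exact.
have natr_inj (a b : nat) : a%:R = b%:R :> algC -> a = b.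
  by move/eqP; rewrite eqr_nat => /eqP.
have deg1 : (\sum_v degree f v = \sum_v degree e v)%N.
  apply: natr_inj; rewrite -(sum_eigenvalues ebf fS.2) -(sum_eigenvalues eb eS.2).
  exact/esym/(cospectral_sum id cnt).
have deg2 : (\sum_v (degree f v ^ 2 + degree f v) = \sum_v (degree e v ^ 2 + degree e v))%N.
  apply: natr_inj; rewrite -(sum_sqr_eigenvalues ebf fS.1 fS.2) -(sum_sqr_eigenvalues eb eS.1 eS.2).
  exact/esym/(cospectral_sum (fun x => x ^+ 2) cnt).
have dsum := @degree_sum_gw _ _ s (fun=> 2%N) s3 k2.
have cW : #|W| = (1 + ncyc s + 2 * q)%N by rewrite -card_eq card_gw // npath2.
have mind := mindegree_ge2 fS.1 fS.2 ebf mu1.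
have [h Dh D3] : exists2 h, degree f h = (#|W| - 1)%N &
    forall v, v != h -> (degree f v <= 3)%N.
  have N1 : (1 + ncyc s + 2 * q - 1 = ncyc s + 2 * q)%N by lia.
  rewrite cW; apply: degree_count => //.
  - by rewrite deg1 -/e N1; move: dsum; rewrite npath2 -/e; lia.
  - by rewrite deg2 N1 fw_degree_sqr.
  - by move=> v; rewrite -cW degree_lt_card //; exact: fS.2.
  - by move=> v1 v2; apply: (second_degree_le4 fS.1 fS.2 ebf mu5 mind).
have hub := full_degree_adj fS.2 Dh.
have [|t' [r [s' [k [s3' k2' iso1]]]]] := hub_graph_iso fS hub.
  by move=> v vh; rewrite mind D3.
have gS : simple_graph (gw_adj s' k) := gw_simple k s3'.
have cosp1 x : Q_eig_mult e x = Q_eig_mult (gw_adj s' k) x.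
  by rewrite cosp (graph_iso_mult gS fS iso1).
have [nu [chi ebg]] := eigenbasis_exists gS.1.
have cnt1 x : #|[pred i | lam i == x]| = #|[pred j | nu j == x]|.
  by rewrite -(eb_mult eb) -(eb_mult ebg).
have card1 : (1 + ncyc s + 2 * q = 1 + ncyc s' + npath k)%N.
  rewrite -cW -card_eq -(card_gw s3' k2').
  by have := cospectral_sum (fun=> 1%N) cnt1; rewrite -!sum1_card; exact.
(* Equal orders and equal degree sums leave only the deficit of 2 per path to compare. *)
have rq : r = q.
  have degg : (\sum_v degree (gw_adj s' k) v = \sum_v degree e v)%N.
    apply: natr_inj; rewrite -(sum_eigenvalues ebg gS.2) -(sum_eigenvalues eb eS.2).
    exact/esym/(cospectral_sum id cnt1).
  have := degree_sum_gw s3' k2'; rewrite degg; move: dsum card1; rewrite npath2 -/e; lia.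
subst r.
have kE j : k j = 2%N.
  apply: (all_paths_K2 s3 s3' k2' n3 _ cosp1).
  by move: n52 card1; rewrite -/(ncyc s); lia.
have {}kE : k = (fun=> 2%N) by apply: functional_extensionality.
subst k; rewrite npath2 in card1.
have nE : ncyc s = ncyc s' by lia.
have P : perm_eq [seq s i | i <- enum 'I_t] [seq s' i | i <- enum 'I_t'].
  (* At a primitive m-th root of unity the resonant cycles are those of length divisible by m;
     [m >= 3] ensures [w^2 != 1]. *)
  apply: perm_eq_from_dvdn; try by apply/allP => x /mapP[i _ ->].
  move=> m m3; have m0 : (0 < m)%N by lia.
  have [z zP] := C_prim_root_exists m0.
  rewrite -!(resonant_prim _ zP); apply: (resonant_card s3 s3' k2 nE cosp1).
    by apply: (root_unity_neq0 m0); apply: prim_expr_order.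
  by rewrite -(prim_order_dvd zP) gtnNdvd.
apply: graph_iso_trans iso0 _; apply: graph_iso_trans iso1.
exact: gw_perm_iso.
Qed.
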